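(* Let $n,p$ be integers with $p\ge3$ and $p+2\le n<2p$, let $N>0$, and let $0<\gamma\le -n+2p$. Observe $Y\in\mathbb R^{n\times p}$ with independent entries $Y_{ai}\sim\mathrm N(M_{ai},N^{-1})$. Then the generalized Bayes estimator with respect to $\pi_{\mathrm{MSVS2}}(M)=\det(M^\top M)^{-(n-p-1)/2}\prod_{i=1}^p\|M_{\cdot i}\|^{-\gamma}$ (where $M_{\cdot i}$ is the $i$-th column of $M$) is minimax under the Frobenius loss $\|\hat M-M\|_{\mathrm F}^2$, i.e., $\sup_M\mathrm E_M\|\hat M-M\|_{\mathrm F}^2\le np/N$.
   Context: The generalized Bayes estimator with respect to a nonnegative function $\pi$ with finite marginal $m_\pi(Y)=\int p(Y\mid M)\pi(M)\,\mathrm dM$ for all $Y$ is the posterior mean $\int Mp(Y\mid M)\pi(M)\,\mathrm dM/m_\pi(Y)$. *)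

(* Defs.v *)
From HB Require Import structures.
From mathcomp Require Import all_boot all_order all_algebra.
From mathcomp Require Import all_classical all_reals all_analysis.
Set Implicit Arguments. Unset Strict Implicit. Unset Printing Implicit Defensive.
Import Order.TTheory GRing.Theory Num.Theory.
Local Open Scope ring_scope.

Section Defs.
Variable R : realType.

Fixpoint iint (I : eqType) (s : seq I) (f : (I -> R) -> \bar R) (x : I -> R)
  {struct s} : \bar R :=
  match s with
  | [::] => f x
  | i :: s' => (\int[@lebesgue_measure R]_(t in [set: R])
                 iint s' f (fun j => if j == i then t else x j))%E
  end.

(* Integral with respect to Lebesgue measure on R^{n x p} = R^{np} of a
   nonnegative function (computed as an iterated integral, Tonelli). *)
Definition matint (n p : nat) (f : 'M[R]_(n, p) -> \bar R) : \bar R :=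
  iint (enum [set: 'I_n * 'I_p]%type)
       (fun x => f (\matrix_(a, i) x (a, i))) (fun _ => 0).

Definition matint_signed (n p : nat) (f : 'M[R]_(n, p) -> R) : \bar R :=
  (matint (fun M => (Num.max (f M) 0)%:E) - matint (fun M => (Num.max (- f M) 0)%:E))%E.

Definition lik (n p : nat) (N : R) (Y M : 'M[R]_(n, p)) : R :=
  \prod_(a < n) \prod_(i < p)
     (Num.sqrt (N / (2 * pi)) * expR (- (N * (Y a i - M a i) ^+ 2) / 2)).

Definition colnorm (n p : nat) (M : 'M[R]_(n, p)) (i : 'I_p) : R :=
  Num.sqrt (\sum_(a < n) M a i ^+ 2).

(* pi_MSVS2(M) = det(M^T M)^{-(n-p-1)/2} prod_i ||M_.i||^{-gamma}
   (powR convention: 0 `^ r = 0 for r <> 0, only on a null set). *)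
Definition pi_MSVS2 (n p : nat) (gamma : R) (M : 'M[R]_(n, p)) : R :=
  (\det (M^T *m M)) `^ (- ((n%:R - p%:R - 1) / 2))
  * \prod_(i < p) (colnorm M i) `^ (- gamma).

Definition marginal (n p : nat) (N : R) (prior : 'M[R]_(n, p) -> R)
  (Y : 'M[R]_(n, p)) : \bar R :=
  matint (fun M => (lik N Y M * prior M)%:E).

Definition gen_bayes (n p : nat) (N : R) (prior : 'M[R]_(n, p) -> R)
  (Y : 'M[R]_(n, p)) : 'M[R]_(n, p) :=
  \matrix_(a, i) (fine (matint_signed (fun M => M a i * lik N Y M * prior M))
                  / fine (marginal N prior Y)).

Definition frob2 (n p : nat) (A : 'M[R]_(n, p)) : R :=
  \sum_(a < n) \sum_(i < p) A a i ^+ 2.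

Definition risk (n p : nat) (N : R) (est : 'M[R]_(n, p) -> 'M[R]_(n, p))
  (M : 'M[R]_(n, p)) : \bar R :=
  matint (fun Y => (lik N Y M * frob2 (est Y - M))%:E).

End Defs.

(* Main.v *)
Require Import Defs.
From HB Require Import structures.
From mathcomp Require Import all_boot all_order all_algebra.
From mathcomp Require Import all_classical all_reals all_analysis.
From mathcomp Require Import measurable_realfun perm ring lra.
Set Implicit Arguments.
Unset Strict Implicit.
Unset Printing Implicit Defensive.
Import Order.TTheory GRing.Theory Num.Theory.
Import numFieldNormedType.Exports.
Local Open Scope ring_scope.

(* Write e for a positive parameter and let q_e be the prior in which M^T M is
   replaced by M^T M + e I and |M_i|^2 by |M_i|^2 + e.  It is smooth and bounded,
   its first and second derivatives are at most C q_e, and an explicit computation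
   shows that it is superharmonic exactly because gamma <= 2p - n.

   Let m be the Gaussian convolution of q_e.  The posterior mean is
   Y + (grad m / m) / N, so by Stein's identity (integration by parts, i.e. the
   derivative at 0 of a translation-invariant integral) its risk is np/N plus the
   expectation of N^-2 (2 (Laplacian m) / m - |grad m|^2 / m^2), which is <= 0.

   To let e tend to 0, note that s |-> E q_e(Y + s Z), Z Gaussian, decreases on
   [0, 1], whence m <= q_e.  At a matrix Y0 with orthonormal columns q_e(Y0) <= 1;
   as q_e tends to +oo where det (M^T M) = 0, Fatou's lemma shows at once that
   this set is negligible and that the prior is integrable against Gaussians
   centred at Y0, hence against all Gaussians.  Dominated convergence then gives
   convergence of the posterior means, and Fatou's lemma passes to the limit in
   the risk. *)

(** * Iterated integrals as integrals on a measure space *)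

(** The obstacle is the singular set of the prior: a direct proof that the marginal is finite would
    need a change of variables to singular values. The mean value inequality for the smooth priors
    replaces it, since a bound that is uniform in e at one single matrix controls all the Gaussian
    integrals.

    The same e is added to the Gram matrix and to the squared column norms because every error made
    in this way has a favourable sign: with T = (M^T M + e I)^-1 one has M^T M T = I - e T, and T is
    at least its e-free part T M^T M T. The exponents of the singular prior can therefore be kept.

    Bounds of the form C q_e, relative to the prior itself, survive convolution: the first and
    second derivatives of m are at most C m. So grad m / m is bounded, and every integration by
    parts takes place against a Gaussian times a polynomial factor, with an explicit dominating
    function.

    Integrals over matrices are given as iterated integrals, not by a measure. They are first
    represented on an abstract sigma-finite space with an evaluation map [ev] into matrices, so that
    convergence theorems apply. *)

Section SigmaFiniteProduct.
Context {d1 d2} {T1 : measurableType d1} {T2 : measurableType d2} {R : realType}.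
Variables (m1 : {sigma_finite_measure set T1 -> \bar R})
          (m2 : {sigma_finite_measure set T2 -> \bar R}).

(* The canonical instance found for [m1 \x m2] is the one for probability
   measures; the alias makes the sigma-finite structure inferable. *)
Definition sfprod : set (T1 * T2) -> \bar R := (m1 \x m2)%E.

HB.instance Definition _ := Measure.on sfprod.

Lemma sigma_finite_sfprod : sigma_finite setT sfprod.
Proof.
have /sigma_finiteP[F [TF ndF Foo]] := sigma_finiteT m1.
have /sigma_finiteP[G [TG ndG Goo]] := sigma_finiteT m2.
exists (fun k => F k `*` G k)%classic => [|k]; last first.
  have [[mF Fk] [mG Gk]] := (Foo k, Goo k); split; first exact: measurableX.
  by rewrite /sfprod product_measure1E// lte_mul_pinfty// ge0_fin_numE.
apply/esym/seteqP; split=> // -[x y] _.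
have [i _ Fi] : (\bigcup_k F k)%classic x by rewrite -TF.
have [j _ Gj] : (\bigcup_k G k)%classic y by rewrite -TG.
(* Both exhausting sequences increase, so the larger index serves both coordinates. *)
exists (maxn i j) => //; split => /=.
  by move: Fi; apply/subsetPset/ndF/leq_maxl.
by move: Gj; apply/subsetPset/ndG/leq_maxr.
Qed.

HB.instance Definition _ :=
  Measure_isSigmaFinite.Build _ _ _ sfprod sigma_finite_sfprod.

End SigmaFiniteProduct.

Section IteratedIntegral.
Variables (R : realType) (I : eqType).
Local Open Scope ereal_scope.

(** The function space is given no sigma-algebra; measurability is tested along every family of
    points with measurable coordinates, which makes it directly usable inside product spaces. *)
Definition coord_measurable (f : (I -> R) -> \bar R) : Prop :=
  forall d (T : measurableType d) (e : T -> I -> R),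
    (forall i, measurable_fun setT (fun t => e t i)) ->
    measurable_fun setT (fun t => f (e t)).

(** Tonelli, by recursion on [s]: each variable adds a factor [R] to the space, starting from a
    point mass. The space depends on [s], hence the existential; a repeated index takes its value
    from the innermost integral. *)
Lemma iint_integral (s : seq I) :
  exists d (T : measurableType d) (mu : {sigma_finite_measure set T -> \bar R})
    (ev : T -> I -> R),
    (forall i, measurable_fun setT (fun v => ev v i)) /\
    forall f x, coord_measurable f -> (forall y, 0 <= f y) ->
      iint s f x = \int[mu]_v f (fun j => if j \in s then ev v j else x j).
Proof.
elim: s => [|i s [d [T [mu [ev [mev IH]]]]]].
  exists _, unit, (@dirac _ unit tt R : {sigma_finite_measure set _ -> \bar R}), (fun _ _
    => 0%R).
  split=> [i|f x mf f0]; first exact: measurable_cst.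
  rewrite [RHS](_ : _ = \int[dirac tt]_v f x) ?integral_dirac ?diracT ?mul1e//.
exists _, _, (sfprod (@lebesgue_measure R) mu).
exists (fun v j => if j \in s then ev v.2 j else v.1).
have mev' j : measurable_fun setT (fun v : measurableTypeR R * T =>
    (if j \in s then ev v.2 j else v.1) : R).
  case: (j \in s); last exact: measurable_fst.
  by apply: (measurableT_comp (mev j)); exact: measurable_snd.
split => // f x mf f0 /=.
rewrite /sfprod fubini_tonelli1//.
- apply: eq_integral => t _; rewrite IH// /fubini_F; apply: eq_integral => v _.
  congr f; apply/funext => j; rewrite inE.
  by case: (j \in s); case: (j == i).
- apply: (mf _ _ (fun (v : measurableTypeR R * T) j => if j \in i :: s then if j \in s
    then ev v.2 j else v.1 else x j)) => j.
  by case: (j \in i :: s); [exact: mev'|exact: measurable_cst].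
Qed.

Lemma measurable_iint_upd (s : seq I) (i : I) (f : (I -> R) -> \bar R) x :
  coord_measurable f -> (forall y, 0 <= f y) ->
  measurable_fun setT (fun t : measurableTypeR R => iint s f (fun j => if j == i then t
    else x j)).
Proof.
move=> mf f0; have [d [T [mu [ev [mev H]]]]] := iint_integral s.
under eq_fun do rewrite H//.
apply: (measurable_fun_fubini_tonelli_F (m2 := mu) (fun tv : measurableTypeR R * T =>
  f (fun j => if j \in s then ev tv.2 j else if j == i then tv.1 else x j))) => //.
apply: (mf _ _ (fun (tv : measurableTypeR R * T) j => if j \in s then ev tv.2 j else if j
  == i then tv.1 else x j)) => j; case: (j \in s).
  by apply: (measurableT_comp (mev j)); exact: measurable_snd.
by case: (j == i); [exact: measurable_fst|exact: measurable_cst].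
Qed.

(** The pushforward of Lebesgue measure under the translation gives each half-open interval its
    length, which characterises Lebesgue measure. *)
Lemma ge0_integral_lebesgue_shift (g : measurableTypeR R -> \bar R) (a : R) :
  measurable_fun setT g -> (forall t, 0 <= g t) ->
  \int[@lebesgue_measure R]_t g (t + a)%R = \int[@lebesgue_measure R]_t g t.
Proof.
move=> mg g0.
have ms : measurable_fun [set: measurableTypeR R] (fun t : measurableTypeR R => (t + a)%R
  : measurableTypeR R).
  by apply: measurable_funD => //; exact: measurable_cst.
have <- := @ge0_integral_pushforward _ _ _ _ R _ ms lebesgue_measure setT g measurableT
  mg (fun y _ => g0 y).
apply: eq_measure_integral => A mA _; apply/esym.
apply: (lebesgue_measure_unique (mu := pushforward lebesgue_measure (fun t :
  measurableTypeR R => (t + a)%R : measurableTypeR R))) => // X [[b c] _ <-].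
rewrite /pushforward/=.
rewrite [X in lebesgue_measure X = _](_ : _ = `]b, c]%classic); last first.
  by apply/seteqP; split=> x /=; rewrite in_itv.
rewrite [X in _ = lebesgue_measure X](_ : _ = `](b - a)%R, (c - a)%R]%classic); last first.
  by apply/seteqP; split=> x /=; rewrite !in_itv/= ltrBlDr lerBrDr.
by rewrite !lebesgue_measure_itv/= !lte_fin ltrD2r; case: ifP => // _; rewrite -!EFinB;
  congr EFin; ring.
Qed.

(** The base point moves too: coordinates outside [s] are not integrated and keep their shift. *)
Lemma iint_shift (s : seq I) (f : (I -> R) -> \bar R) (w x : I -> R) :
  coord_measurable f -> (forall y, 0 <= f y) ->
  iint s (fun y => f (y \+ w)%R) x = iint s f (x \+ w)%R.
Proof.
move=> mf f0; elim: s x => //= i s IH x.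
rewrite -[RHS](@ge0_integral_lebesgue_shift _ (w i)) /=; last 2 first.
- exact: measurable_iint_upd.
- move=> t; have [d [T [mu [ev [mev H]]]]] := iint_integral s.
  by rewrite H//; apply: integral_ge0.
apply: eq_integral => t _; rewrite IH; congr (iint s f); apply/funext => j /=.
by case: eqP => [->|].
Qed.

(** The factor [K] carries the induction: the head variable is constant for the inner integral, so
    its density is moved into [K], which only sees coordinates outside the remaining list. *)
Lemma iint_prod (s : seq I) (g : I -> R -> R) (K : (I -> R) -> R) x :
  uniq s -> (forall i t, 0 <= g i t)%R -> (forall i, measurable_fun setT (fun t :
    measurableTypeR R => g i t)) ->
  (forall i, \int[@lebesgue_measure R]_t (g i t)%:E = 1) ->
  (forall y, 0 <= K y)%R ->
  (forall y z, {in [predC s], y =1 z} -> K y = K z) ->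
  iint s (fun y => (K y * \prod_(i <- s) g i (y i))%:E) x = (K x)%:E.
Proof.
move=> us g0 mg g1; elim: s us K x => [|i s IH] us K x K0 Ks /=.
  by rewrite big_nil mulr1.
move: us => /= /andP[nis us].
under eq_integral => t _.
  under [X in iint _ X]eq_fun do rewrite big_cons mulrA.
  rewrite IH//; last 2 first.
  - by move=> y; rewrite mulr_ge0.
  - move=> y z yz; rewrite (yz i) ?inE//; congr *%R; apply: Ks => j.
    by rewrite !inE negb_or => /andP[_ js]; exact: yz.
  rewrite eqxx [K _](_ : _ = K x); last first.
    by apply: Ks => j; rewrite !inE negb_or => /andP[/negPf-> _].
  rewrite EFinM.
over.
rewrite ge0_integralZl//; [by rewrite g1 mule1| |by move=> t _; rewrite lee_fin|by
  rewrite lee_fin].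
apply/measurable_EFinP; exact: mg.
Qed.
End IteratedIntegral.

(** * Integrals over matrix space and the total mass of the likelihood *)

Section MatrixIntegral.
Variable R : realType.

Definition mx_measurable n p d' (U : sigmaRingType d') (f : 'M[R]_(n, p) -> U) : Prop :=
  forall d (T : measurableType d) (e : T -> 'M[R]_(n, p)),
    (forall a i, measurable_fun setT (fun t => e t a i)) ->
    measurable_fun setT (fun t => f (e t)).

Lemma mx_measurable_coord n p (f : 'M[R]_(n, p) -> \bar R) :
  mx_measurable f ->
  coord_measurable (fun x : 'I_n * 'I_p -> R => f (\matrix_(a, i) x (a, i))).
Proof.
move=> mf d T e me; apply: mf => a i; under eq_fun do rewrite mxE; exact: me.
Qed.

Lemma matint_integral n p :
  exists d (T : measurableType d) (mu : {sigma_finite_measure set T -> \bar R})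
    (ev : T -> 'M[R]_(n, p)),
    (forall a i, measurable_fun setT (fun v => ev v a i)) /\
    forall f, mx_measurable f -> (forall M, (0 <= f M)%E) ->
      matint f = (\int[mu]_v f (ev v))%E.
Proof.
have [d [T [mu [ev [mev H]]]]] := iint_integral R (enum [set: 'I_n * 'I_p]).
exists d, T, mu, (fun v => \matrix_(a, i) ev v (a, i)); split=> [a i|f mf f0].
  by under eq_fun do rewrite mxE; exact: mev.
rewrite /matint H//; last exact: mx_measurable_coord.
apply: eq_integral => v _; congr f; apply/matrixP => a i.
by rewrite !mxE mem_enum inE.
Qed.

Lemma matint_shift n p (f : 'M[R]_(n, p) -> \bar R) W :
  mx_measurable f -> (forall M, 0 <= f M)%E ->
  matint (fun M => f (M + W)) = matint f.
Proof.
move=> mf f0; rewrite /matint.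
pose w (k : 'I_n * 'I_p) := W k.1 k.2.
transitivity (iint (enum [set: 'I_n * 'I_p]) (fun x => f (\matrix_(a, i) (x \+ w) (a,
  i))) (fun=> 0)).
  congr iint; apply/funext => x; congr f; apply/matrixP => a i; by rewrite !mxE.
rewrite (iint_shift _ (f := fun x => f (\matrix_(a, i) x (a, i))))//.
  have [d [T [mu [ev [mev H]]]]] := iint_integral R (enum [set: 'I_n * 'I_p]).
  rewrite !H//; last 2 first.
  - exact: mx_measurable_coord.
  - exact: mx_measurable_coord.
  apply: eq_integral => v _; congr f; apply/matrixP => a i.
  by rewrite !mxE mem_enum inE.
exact: mx_measurable_coord.
Qed.

Lemma lik_pairE n p (N : R) (Y M : 'M[R]_(n, p)) :
  lik N Y M = \prod_(k : 'I_n * 'I_p)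
    (Num.sqrt (N / (2 * pi)) * expR (- (N * (Y k.1 k.2 - M k.1 k.2) ^+ 2) / 2)).
Proof. by rewrite /lik pair_big. Qed.

Lemma integral_gauss_factor (N y : R) : 0 < N ->
  (\int[@lebesgue_measure R]_t
    (Num.sqrt (N / (2 * pi)) * expR (- (N * (y - t) ^+ 2) / 2))%:E = 1)%E.
Proof.
move=> N0; rewrite -(integral_normal_pdf y (Num.sqrt N^-1)).
apply: eq_integral => t _; congr EFin.
rewrite normal_pdfE ?gt_eqF ?sqrtr_gt0 ?invr_gt0// /normal_peak /normal_fun.
rewrite sqr_sqrtr ?invr_ge0 ?ltW// -sqrtrV; last first.
  by rewrite mulrn_wge0// mulr_ge0 ?pi_ge0// invr_ge0 ltW.
congr (Num.sqrt _ * expR _).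
  by rewrite -mulr_natr; move: (@pi_gt0 R); move: (pi : R) => q q0; field; rewrite !gt_eqF.
by rewrite -mulr_natr; field; rewrite gt_eqF.
Qed.

Lemma matint_lik n p (N : R) (Y : 'M[R]_(n, p)) : 0 < N ->
  matint (fun M => (lik N Y M)%:E) = 1%E.
Proof.
move=> N0; rewrite /matint.
pose g (k : 'I_n * 'I_p) t := Num.sqrt (N / (2 * pi)) * expR (- (N * (Y k.1 k.2 - t) ^+
  2) / 2).
have -> : (fun x => (lik N Y (\matrix_(a, i) x (a, i)))%:E) =
   (fun x => (cst 1 x * \prod_(k <- enum [set: 'I_n * 'I_p]) g k (x k))%:E).
  apply/funext => x; rewrite mul1r lik_pairE big_enum.
  by apply: congr1; apply: eq_big => [k|[a i] _]; rewrite ?inE//= /g mxE.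
rewrite iint_prod//.
- exact: enum_uniq.
- by move=> i t; rewrite mulr_ge0 ?sqrtr_ge0 ?expR_ge0.
- move=> k; apply: measurable_funM => //; apply: measurableT_comp => //.
  apply: measurable_funM => //; apply: measurableT_comp => //.
  apply: measurable_funM => //; apply: measurable_funX.
  exact: measurable_funB.
- by move=> i; exact: integral_gauss_factor.
Qed.

End MatrixIntegral.

Local Open Scope classical_set_scope.
Local Open Scope ring_scope.

(** * Real derivatives and measurability of functions of a matrix *)

Section RealDerivatives.
Variable R : realType.
Implicit Types (f g : R -> R) (x l : R).

Lemma is_derive_ext f g x l :
  (forall t, f t = g t) -> is_derive x 1 f l -> is_derive x 1 g l.
Proof. by move=> /funext ->. Qed.

Lemma is_derive1D f g x a b : is_derive x 1 f a -> is_derive x 1 g b ->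
  is_derive x 1 (fun t => f t + g t) (a + b).
Proof. by move=> fa gb; exact: is_deriveD. Qed.

Lemma is_derive1B f g x a b : is_derive x 1 f a -> is_derive x 1 g b ->
  is_derive x 1 (fun t => f t - g t) (a - b).
Proof. by move=> fa gb; exact: is_deriveB. Qed.

Lemma is_derive1M f g x a b : is_derive x 1 f a -> is_derive x 1 g b ->
  is_derive x 1 (fun t => f t * g t) (a * g x + f x * b).
Proof.
by move=> fa gb; apply: is_derive_eq; rewrite addrC; congr (_ + _); rewrite
  /GRing.scale/= mulrC.
Qed.

Lemma is_derive1c (c : R) x : is_derive x 1 (fun=> c) 0.
Proof. exact: is_derive_cst. Qed.

Lemma is_derive1id x : is_derive x 1 (fun t : R => t) 1.
Proof. exact: is_derive_id. Qed.

Lemma is_derive1Mc f x l (c : R) : is_derive x 1 f l -> is_derive x 1 (fun t => c * f t)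
  (c * l).
Proof. by move=> fl; have := is_derive1M (is_derive1c c x) fl; rewrite mul0r add0r. Qed.

Lemma is_derive1V f x l : f x != 0 -> is_derive x 1 f l ->
  is_derive x 1 (fun t => (f t)^-1) (- l / f x ^+ 2).
Proof.
move=> fx0 fl; have := is_deriveV fx0 fl; congr (is_derive _ _ _ _).
by rewrite /GRing.scale/= mulNr mulrC mulNr.
Qed.

Lemma is_derive1_sum (I : Type) (s : seq I) (h : I -> R -> R) (dh : I -> R) x :
  (forall i, is_derive x 1 (h i) (dh i)) ->
  is_derive x 1 (fun t => \sum_(i <- s) h i t) (\sum_(i <- s) dh i).
Proof.
move=> hd; elim: s => [|i s IH].
  rewrite big_nil; apply: is_derive_ext (is_derive1c 0 x) => t; by rewrite big_nil.
rewrite big_cons; apply: is_derive_ext (is_derive1D (hd i) IH) => t; by rewrite big_cons.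
Qed.

Lemma is_derive1_chain f g x a b : is_derive (g x) 1 f a -> is_derive x 1 g b ->
  is_derive x 1 (fun t => f (g t)) (a * b).
Proof. by move=> fa gb; exact: is_derive1_comp. Qed.

Lemma is_derive1_affine (c b : R) x : is_derive x 1 (fun t => c * t + b) c.
Proof.
have := is_derive1D (is_derive1Mc c (is_derive1id x)) (is_derive1c b x).
by rewrite mulr1 addr0.
Qed.

Lemma is_derive1_expR f x l : is_derive x 1 f l ->
  is_derive x 1 (fun t => expR (f t)) (l * expR (f x)).
Proof. by move=> fl; rewrite mulrC; apply: is_derive1_chain => //; exact: is_derive_expR. Qed.

Lemma is_derive1_lnR f x l : 0 < f x -> is_derive x 1 f l ->
  is_derive x 1 (fun t => ln (f t)) (l / f x).
Proof. by move=> f0 fl; rewrite mulrC; apply: is_derive1_chain => //; exact: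
  is_derive1_ln. Qed.

Lemma is_derive1_cvg f x l : is_derive x 1 f l ->
  (fun k : nat => k.+1%:R * (f (x + k.+1%:R^-1) - f x)) @ \oo --> l.
Proof.
move=> [df <-].
pose u k : R := k.+1%:R^-1.
have u0 : u @ \oo --> (0:R) by exact: cvg_harmonic.
have un k : u k != 0 by rewrite invr_eq0 pnatr_eq0.
have := df => /cvgr_dnbhsP /(_ u (conj un u0)).
apply: cvg_trans; apply: near_eq_cvg; near=> k.
by rewrite /u /= /GRing.scale/= invrK mulr1 [_ + x]addrC.
Unshelve. all: end_near. Qed.

End RealDerivatives.

Section MatrixMeasurability.
Variables (R : realType) (n p : nat).
Implicit Types (f g : 'M[R]_(n, p) -> R).

Lemma mx_measurable_ext d (U : sigmaRingType d) (f g : 'M[R]_(n, p) -> U) :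
  (forall M, g M = f M) -> mx_measurable f -> mx_measurable g.
Proof. by move=> /funext ->. Qed.

Lemma mx_measurable_cst (c : R) : mx_measurable (fun _ : 'M[R]_(n, p) => c).
Proof. by move=> d T e me; exact: measurable_cst. Qed.

Lemma mx_measurable_coef a i : mx_measurable (fun M : 'M[R]_(n, p) => M a i).
Proof. by move=> d T e me; exact: me. Qed.

Lemma mx_measurableD f g : mx_measurable f -> mx_measurable g ->
  mx_measurable (fun M => f M + g M).
Proof. by move=> mf mg d T e me; apply: measurable_funD; [exact: mf|exact: mg]. Qed.

Lemma mx_measurableM f g : mx_measurable f -> mx_measurable g ->
  mx_measurable (fun M => f M * g M).
Proof. by move=> mf mg d T e me; apply: measurable_funM; [exact: mf|exact: mg]. Qed.

Lemma mx_measurable_comp (h : R -> R) f : measurable_fun setT h -> mx_measurable f ->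
  mx_measurable (fun M => h (f M)).
Proof. by move=> mh mf d T e me; apply: (measurableT_comp mh); exact: mf. Qed.

Lemma mx_measurableN f : mx_measurable f -> mx_measurable (fun M => - f M).
Proof. by apply: mx_measurable_comp; exact: measurable_funN. Qed.

Lemma mx_measurableV f : (forall M, 0 <= f M) -> mx_measurable f ->
  mx_measurable (fun M => (f M)^-1).
Proof.
move=> f0 mf; apply: (mx_measurable_ext (f := fun M => f M `^ (-1))) => [M|].
  by rewrite powR_inv1.
by apply: (mx_measurable_comp (h := fun x => x `^ (-1))) => //; exact: measurable_powR.
Qed.

Lemma mx_measurable_sum (I : Type) (s : seq I) (h : I -> 'M[R]_(n, p) -> R) :
  (forall i, mx_measurable (h i)) -> mx_measurable (fun M => \sum_(i <- s) h i M).
Proof.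
move=> mh; elim: s => [|i s IH].
  by apply: mx_measurable_ext (mx_measurable_cst _) => M; rewrite big_nil.
by apply: mx_measurable_ext (mx_measurableD (mh i) IH) => M; rewrite big_cons.
Qed.

Lemma mx_measurable_prod (I : Type) (s : seq I) (h : I -> 'M[R]_(n, p) -> R) :
  (forall i, mx_measurable (h i)) -> mx_measurable (fun M => \prod_(i <- s) h i M).
Proof.
move=> mh; elim: s => [|i s IH].
  by apply: mx_measurable_ext (mx_measurable_cst _) => M; rewrite big_nil.
by apply: mx_measurable_ext (mx_measurableM (mh i) IH) => M; rewrite big_cons.
Qed.

Lemma mx_measurable_affine n' p' d (U : sigmaRingType d) (f : 'M[R]_(n', p') -> U)
    (A : 'M[R]_(n, p) -> 'M[R]_(n', p')) :
  (forall a i, mx_measurable (fun M => A M a i)) ->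
  mx_measurable f -> mx_measurable (fun M => f (A M)).
Proof. by move=> mA mf d' T e me; apply: mf => a i; exact: mA. Qed.

Lemma mx_measurable_shift d (U : sigmaRingType d) (f : 'M[R]_(n, p) -> U) Y (s : R) :
  mx_measurable f -> mx_measurable (fun M => f (Y + s *: M)).
Proof.
apply: mx_measurable_affine => a i.
apply: (mx_measurable_ext (f := fun M => Y a i + s * M a i)) => [M|]; first by rewrite !mxE.
apply: mx_measurableD; first exact: mx_measurable_cst.
by apply: mx_measurableM; [exact: mx_measurable_cst|exact: mx_measurable_coef].
Qed.

Lemma mx_measurable_cvg (u : nat -> 'M[R]_(n, p) -> R) f :
  (forall k, mx_measurable (u k)) -> (forall M, u^~ M @ \oo --> f M) ->
  mx_measurable f.
Proof.
move=> mu uf d T e me; apply: (measurable_fun_cvg (h := fun k t => u k (e t))).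
  by move=> k; exact: mu.
by move=> t _; exact: uf.
Qed.

Lemma mx_measurable_EFin f : mx_measurable f -> mx_measurable (fun M => (f M)%:E).
Proof. by move=> mf d T e me; apply/measurable_EFinP; exact: mf. Qed.

Definition dir_derive f W M (l : R) := is_derive (0 : R) 1 (fun t => f (M + t *: W)) l.

(** A derivative is the pointwise limit of the difference quotients with step [1/(k+1)]. Gradients
    and Hessians get their measurability from here, without a look at their formulas. *)
Lemma mx_measurable_dir_derive f W g : mx_measurable f ->
  (forall M, dir_derive f W M (g M)) -> mx_measurable g.
Proof.
move=> mf fg; apply: (mx_measurable_cvg (u := fun k M => k.+1%:R * (f (M + k.+1%:R^-1 *:
  W) - f M))).
  move=> k; apply: mx_measurableM; first exact: mx_measurable_cst.
  apply: mx_measurableD; last exact: mx_measurableN.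
  have := @mx_measurable_shift _ _ f (k.+1%:R^-1 *: W) 1 mf.
  by under eq_fun do rewrite scale1r addrC.
move=> M; have := is_derive1_cvg (fg M).
by rewrite /= scale0r addr0; under eq_fun do rewrite add0r.
Qed.

Lemma dir_derive_at f W g M (s x : R) : (forall M, dir_derive f W M (g M)) ->
  is_derive x 1 (fun t => f (M + (s * t) *: W)) (s * g (M + (s * x) *: W)).
Proof.
move=> fg; have := fg (M + (s * x) *: W).
rewrite /dir_derive => fgx.
have h : is_derive x 1 (fun t => s * t - s * x) s by exact: is_derive1_affine.
have fgx' : is_derive (s * x - s * x) 1 (fun t => f (M + (s * x) *: W + t *: W)) (g (M +
  (s * x) *: W)).
  by rewrite subrr.
rewrite mulrC; apply: is_derive_ext (is_derive1_chain (g := fun t => s * t - s * x) fgx'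
  h) => t.
by rewrite -addrA -scalerDl addrCA subrr addr0.
Qed.

End MatrixMeasurability.

(** * Gaussian bounds *)

Section Gaussian.
Variables (R : realType) (n p : nat).
Implicit Types (M W Y : 'M[R]_(n, p)) (c b t N : R).

Definition mxdot M W : R := \sum_(a < n) \sum_(i < p) M a i * W a i.

Definition gauss c M : R := expR (- (c * frob2 M)).

Definition lik_peak N : R := Num.sqrt (N / (2 * pi)) ^+ (n * p).

Lemma lik_peak_gt0 N : 0 < N -> 0 < lik_peak N.
Proof.
by move=> N0; rewrite exprn_gt0// sqrtr_gt0 divr_gt0// mulr_gt0// pi_gt0.
Qed.

Lemma lik_gauss N Y M : lik N Y M = lik_peak N * gauss (N / 2) (M - Y).
Proof.
rewrite lik_pairE big_split/= prodr_const card_prod !card_ord; congr (_ * _).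
rewrite -expR_sum; congr expR; rewrite /frob2 pair_big/= mulr_sumr -sumrN.
by apply: eq_bigr => -[a i] _ /=; rewrite !mxE; lra.
Qed.

Lemma lik_gt0 N Y M : 0 < N -> 0 < lik N Y M.
Proof. by move=> N0; rewrite lik_gauss mulr_gt0 ?lik_peak_gt0 ?expR_gt0. Qed.

Lemma lik_shift N Y W M : lik N (Y + W) (M + W) = lik N Y M.
Proof. by rewrite !lik_gauss opprD addrACA subrr addr0. Qed.

Lemma frob2N M : frob2 (- M) = frob2 M.
Proof. by apply: eq_bigr => a _; apply: eq_bigr => i _; rewrite mxE sqrrN. Qed.

Lemma lik_sym N Y M : lik N Y M = lik N M Y.
Proof. by rewrite !lik_gauss /gauss -(frob2N (M - Y)) opprB. Qed.

Lemma frob2_line M W t :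
  frob2 (M + t *: W) = frob2 M + t * (2 * mxdot M W) + t ^+ 2 * frob2 W.
Proof.
rewrite /frob2 /mxdot !mulr_sumr -!big_split/=; apply: eq_bigr => a _.
rewrite !mulr_sumr -!big_split/=; apply: eq_bigr => i _.
by rewrite !mxE; ring.
Qed.

Lemma mxdot_delta M a i : mxdot M (delta_mx a i) = M a i.
Proof.
rewrite /mxdot (bigD1 a)//= (bigD1 i)//= mxE !eqxx mulr1 !big1 ?addr0//.
- by move=> b ba; rewrite big1// => j _; rewrite mxE (negPf ba) mulr0.
- by move=> j ji; rewrite mxE (negPf ji) andbF mulr0.
Qed.

Lemma frob2_delta a i : frob2 (delta_mx a i : 'M[R]_(n, p)) = 1.
Proof.
have -> : frob2 (delta_mx a i : 'M[R]_(n, p)) = mxdot (delta_mx a i) (delta_mx a i).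
  by apply: eq_bigr => b _; apply: eq_bigr => j _; rewrite expr2.
by rewrite mxdot_delta mxE !eqxx.
Qed.

Lemma frob2_ge0 M : 0 <= frob2 M.
Proof. by apply: sumr_ge0 => a _; apply: sumr_ge0 => i _; exact: sqr_ge0. Qed.

Lemma coef_le_frob2 M a i : M a i ^+ 2 <= frob2 M.
Proof.
rewrite /frob2 (bigD1 a)//= (bigD1 i)//= -addrA lerDl addr_ge0//.
  by apply: sumr_ge0 => j _; exact: sqr_ge0.
by apply: sumr_ge0 => b _; apply: sumr_ge0 => j _; exact: sqr_ge0.
Qed.

Lemma dir_derive_lik N Y W M :
  dir_derive (lik N Y) W M (- N * mxdot (M - Y) W * lik N Y M).
Proof.
pose q t := - (N / 2 * frob2 (M - Y + t *: W)).
have dq : is_derive (0 : R) 1 q (- (N / 2 * (2 * mxdot (M - Y) W))).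
  have h : is_derive (0 : R) 1 (fun t => frob2 (M - Y) + (t * (2 * mxdot (M - Y) W)) + t
    * (t * frob2 W)) (0 + (1 * (2 * mxdot (M - Y) W) + 0 * 0) + (1 * (0 * frob2 W) + 0 *
    (1 * frob2 W + 0 * 0))).
    apply: is_derive1D.
      exact: (is_derive1D (is_derive1c _ _) (is_derive1M (is_derive1id _) (is_derive1c _ _))).
    exact: (is_derive1M (is_derive1id _) (is_derive1M (is_derive1id _) (is_derive1c _ _))).
  move: h; rewrite !mul0r ?mulr0 !addr0 add0r mul1r => /(is_derive1Mc (- (N / 2))).
  rewrite mulNr; apply: is_derive_ext => t; rewrite /q frob2_line.
  by move: (frob2 (M - Y)) (mxdot _ _) (frob2 W) => A B C; ring.
have q0 : expR (q 0) = gauss (N / 2) (M - Y) by rewrite /q scale0r addr0.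
have -> : - N * mxdot (M - Y) W * lik N Y M =
    lik_peak N * (- (N / 2 * (2 * mxdot (M - Y) W)) * expR (q 0)).
  by rewrite q0 lik_gauss; move: (gauss _ _) (mxdot _ _) (lik_peak N) => A B C; field.
apply: is_derive_ext (is_derive1Mc (lik_peak N) (is_derive1_expR dq)) => t.
by rewrite lik_gauss addrAC.
Qed.

(** Completing the square, [b x <= b^2/(2c) + (c/2) x^2]: an exponential of one entry costs half the
    rate of the Gaussian and a constant. *)
Lemma gauss_absorb b c M a i : 0 < c ->
  expR (b * `|M a i|) * gauss c M <= expR (b ^+ 2 / (2 * c)) * gauss (c / 2) M.
Proof.
move=> c0; rewrite -!expRD ler_expR.
have := coef_le_frob2 M a i; rewrite -[M a i ^+ 2]real_normK ?num_real//.
move: `|M a i| (frob2 M) => x F xF.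
have h : b * x <= b ^+ 2 / (2 * c) + c / 2 * x ^+ 2.
  rewrite -subr_ge0 (_ : _ - _ = (b - c * x) ^+ 2 / (2 * c)); last by field; rewrite gt_eqF.
  by rewrite divr_ge0 ?sqr_ge0// mulr_ge0// ltW.
have : c / 2 * x ^+ 2 <= c / 2 * F by rewrite ler_pM2l// divr_gt0.
lra.
Qed.

Lemma gauss_shift_le c M a i t : 0 < c -> `|t| <= 1 ->
  gauss c (M + t *: delta_mx a i) <= expR (2 * c * `|M a i|) * gauss c M.
Proof.
move=> c0 t1; rewrite -expRD ler_expR frob2_line mxdot_delta frob2_delta.
have : - (t * M a i) <= `|M a i|.
  by rewrite (le_trans (ler_norm _))// normrN normrM ler_piMl.
move: `|M a i| => x hx; have := sqr_ge0 t; nra.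
Qed.

(** A bound uniform in [t], needed to differentiate a translated integral. The factor 2 comes from
    [2 + x <= 2 * expR x]; the exponent [1 + 2 * c] joins this exponential to the one produced by
    shifting the Gaussian. *)
Lemma gauss_shift_bound c M a i t : 0 < c -> `|t| <= 1 ->
  (1 + `|(M + t *: delta_mx a i) a i|) * gauss c (M + t *: delta_mx a i) <=
  2 * expR ((1 + 2 * c) ^+ 2 / (2 * c)) * gauss (c / 2) M.
Proof.
move=> c0 t1; rewrite -mulrA.
apply: le_trans (_ : 2 * (expR ((1 + 2 * c) * `|M a i|) * gauss c M) <= _); last first.
  by rewrite ler_pM2l// gauss_absorb.
rewrite [(1 + 2 * c) * _]mulrDl mul1r expRD -[expR _ * _ * _]mulrA [leRHS]mulrA ler_pM//.
- exact: expR_ge0.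
- rewrite !mxE !eqxx mulr1 (le_trans (_ : _ <= 1 + (`|M a i| + `|t|)))//.
    by rewrite lerD2l ler_normD.
  by have := expR_ge1Dx `|M a i|; have := normr_ge0 (M a i); lra.
- exact: gauss_shift_le.
Qed.

Lemma mx_measurable_frob2 : mx_measurable (@frob2 R n p).
Proof.
apply: mx_measurable_sum => a; apply: mx_measurable_sum => i.
by apply: (mx_measurable_comp (h := fun x => x ^+ 2)); [exact: measurable_funX|exact:
  mx_measurable_coef].
Qed.

Lemma mx_measurable_lik N Y : mx_measurable (lik N Y).
Proof.
apply: (mx_measurable_ext (f := fun M => lik_peak N * gauss (N / 2) (- Y + 1 *: M))).
  by move=> M; rewrite lik_gauss scale1r addrC.
apply: mx_measurableM; first exact: mx_measurable_cst.
apply: (mx_measurable_shift (f := gauss _)); apply: mx_measurable_comp => //.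
apply: mx_measurableN; apply: mx_measurableM; [exact: mx_measurable_cst|exact:
  mx_measurable_frob2].
Qed.

End Gaussian.

(** * Integration by parts *)

Section MatrixSpace.
Context (R : realType) (n p : nat) d (T : measurableType d).
Variables (mu : {sigma_finite_measure set T -> \bar R}) (ev : T -> 'M[R]_(n, p)).
Hypothesis mev : forall a i, measurable_fun setT (fun v => ev v a i).
Hypothesis matintE : forall f, mx_measurable f -> (forall M, (0 <= f M)%E) ->
  matint f = (\int[mu]_v f (ev v))%E.
Implicit Types (f g : 'M[R]_(n, p) -> R) (M W Y : 'M[R]_(n, p)).

Definition mx_Rintegral f : R := \int[mu]_v f (ev v).
Definition mx_integrable f := mu.-integrable setT (fun v => (f (ev v))%:E).

Local Notation mxint := mx_Rintegral.
Local Notation mxintegrable := mx_integrable.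

Lemma measurable_mxint_fun f : mx_measurable f ->
  measurable_fun setT (fun v => (f (ev v))%:E).
Proof. by move=> mf; apply/measurable_EFinP; exact: mf. Qed.

(** The space [T] has no translations of its own, so invariance is imported from the iterated
    integral through [matintE]. *)
Lemma ge0_integral_mx_shift (f : 'M[R]_(n, p) -> \bar R) W :
  mx_measurable f -> (forall M, 0 <= f M)%E ->
  (\int[mu]_v f (W + ev v)%R = \int[mu]_v f (ev v))%E.
Proof.
move=> mf f0; rewrite -[RHS]matintE// -(matint_shift W)// matintE//.
  by apply: eq_integral => v _; rewrite addrC.
have := @mx_measurable_shift _ _ _ _ _ f W 1 mf.
by apply: mx_measurable_ext => M; rewrite scale1r addrC.
Qed.

Lemma mx_measurable_shift1 d' (U : sigmaRingType d') (f : 'M[R]_(n, p) -> U) W :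
  mx_measurable f -> mx_measurable (fun M => f (W + M)).
Proof.
move=> mf; have := @mx_measurable_shift _ _ _ _ _ f W 1 mf.
by apply: mx_measurable_ext => M; rewrite scale1r.
Qed.

Lemma mxint_shift f W : mx_measurable f -> mxint (fun M => f (W + M)) = mxint f.
Proof.
move=> mf; rewrite /mx_Rintegral /Rintegral; congr fine; rewrite integralE [RHS]integralE.
have h g : mx_measurable g ->
    (\int[mu]_v maxe (g (W + ev v)%R)%:E 0 = \int[mu]_v maxe (g (ev v))%:E 0)%E.
  move=> mg; apply: (ge0_integral_mx_shift (f := fun M => maxe (g M)%:E 0)).
    move=> d' U e me; apply: measurable_maxe; last exact: measurable_cst.
    by apply/measurable_EFinP; exact: mg.
  by move=> M; rewrite le_max lexx orbT.
congr (_ - _)%E.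
  by under eq_integral do rewrite funeposE; under [RHS]eq_integral do rewrite funeposE;
    exact: (h _ mf).
under eq_integral do rewrite funenegE -EFinN; under [RHS]eq_integral do rewrite funenegE
  -EFinN.
exact: (h _ (mx_measurableN mf)).
Qed.

Lemma mxint_lik N Y : 0 < N -> (\int[mu]_v (lik N Y (ev v))%:E = 1)%E.
Proof.
move=> N0; rewrite -(matint_lik Y N0) [RHS]matintE//.
- by apply: mx_measurable_EFin; exact: mx_measurable_lik.
- by move=> M; rewrite lee_fin ltW// lik_gt0.
Qed.

Lemma mxintegrable_lik N Y : 0 < N -> mxintegrable (lik N Y).
Proof.
move=> N0; apply/integrableP; split.
  by apply: measurable_mxint_fun; exact: mx_measurable_lik.
under eq_integral do rewrite gee0_abs ?lee_fin ?ltW ?lik_gt0//.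
by rewrite mxint_lik// ltry.
Qed.

Lemma mxintegrable_le f g : mx_measurable f -> (forall M, `|f M| <= g M) ->
  mxintegrable g -> mxintegrable f.
Proof.
move=> mf fg ig; apply: le_integrable ig => //; first exact: measurable_mxint_fun.
by move=> v _; rewrite lee_fin (le_trans (fg _))// ler_norm.
Qed.

Lemma mxintegrableZ (c : R) f : mxintegrable f -> mxintegrable (fun M => c * f M).
Proof. by move=> fi; have := integrableZl measurableT c fi. Qed.

Lemma mxintegrableD f g : mxintegrable f -> mxintegrable g ->
  mxintegrable (fun M => f M + g M).
Proof. by move=> fi gi; have := integrableD measurableT fi gi. Qed.

Lemma mxintegrable_gauss c Y : 0 < c -> mxintegrable (fun M => gauss c (M - Y)).
Proof.
move=> c0; have c20 : 0 < 2 * c by rewrite mulr_gt0.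
have := mxintegrableZ (lik_peak n p (2 * c))^-1 (mxintegrable_lik Y c20).
congr mxintegrable; apply/funext => M; rewrite lik_gauss mulKf ?gt_eqF ?lik_peak_gt0//.
by rewrite [2 * c]mulrC mulfK.
Qed.

Lemma mxintD f g : mxintegrable f -> mxintegrable g ->
  mxint (fun M => f M + g M) = mxint f + mxint g.
Proof. by move=> fi gi; exact: RintegralD. Qed.

Lemma mxintZ c f : mxintegrable f -> mxint (fun M => c * f M) = c * mxint f.
Proof. by move=> fi; exact: RintegralZl. Qed.

Lemma le_mxint f g : mxintegrable f -> mxintegrable g ->
  (forall M, f M <= g M) -> mxint f <= mxint g.
Proof. by move=> fi gi fg; apply: le_Rintegral => // v _; exact: fg. Qed.

Lemma mxint_sum (I : Type) (s : seq I) (h : I -> 'M[R]_(n, p) -> R) :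
  (forall k, mxintegrable (h k)) ->
  mxintegrable (fun M => \sum_(k <- s) h k M) /\
  mxint (fun M => \sum_(k <- s) h k M) = \sum_(k <- s) mxint (h k).
Proof.
move=> hi; elim: s => [|k s [IHi IH]].
  split; last first.
    rewrite big_nil /mx_Rintegral /Rintegral; under eq_integral do rewrite big_nil.
    by rewrite integral0.
  by rewrite /mx_integrable; under eq_fun do rewrite big_nil; exact: integrable0.
split.
  by have := mxintegrableD (hi k) IHi; congr mxintegrable; apply/funext => M; rewrite big_cons.
rewrite big_cons -IH -mxintD//; congr mxint; apply/funext => M; by rewrite big_cons.
Qed.

Lemma mxint_lik1 N Y : 0 < N -> mxint (lik N Y) = 1.
Proof. by move=> N0; rewrite /mx_Rintegral /Rintegral mxint_lik. Qed.

Lemma is_derive_mxint (h dh : R -> 'M[R]_(n, p) -> R) g (u v x : R) :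
  u < x < v ->
  (forall t, mx_measurable (h t)) ->
  (forall t, u < t < v -> mxintegrable (h t)) ->
  (forall t M, u < t < v -> is_derive t 1 (h^~ M) (dh t M)) ->
  (forall t M, u < t < v -> `|dh t M| <= g M) -> mxintegrable g ->
  is_derive x 1 (fun t => mxint (h t)) (mxint (dh x)).
Proof.
move=> uxv mh ih hd dg ig.
have Ix : `]u, v[%classic x by rewrite /= in_itv.
have H1 t : `]u, v[%classic t -> mu.-integrable setT (EFin \o (fun w => h t (ev w))).
  by rewrite /= in_itv => /ih.
have H2 t w : `]u, v[%classic t -> setT w -> derivable (fun s => h s (ev w)) t 1.
  by rewrite /= in_itv => /hd h1 _; case: (h1 (ev w)).
have H3 w : 0 <= g (ev w) by apply: le_trans (dg x (ev w) uxv); exact: normr_ge0.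
have E t w : u < t < v -> partial1of2 (fun s w => h s (ev w)) t w = dh t (ev w).
  by move=> uv; rewrite partial1of2E; case: (hd t (ev w) uv).
have H4 t w : `]u, v[%classic t -> setT w -> `|partial1of2 (fun s w => h s (ev w)) t w|
  <= g (ev w).
  by rewrite /= in_itv => /= uv _; rewrite E//; exact: dg.
split; first exact: (derivable_under_integral measurableT Ix H1 H2 H3 ig H4).
rewrite -derive1E (differentiation_under_integral measurableT Ix H1 H2 H3 ig H4).
by apply: eq_Rintegral => w _; exact: E.
Qed.

(* The integral of [F] is invariant under translation along a coordinate;
   differentiating this at [0] gives the claim. *)
Lemma mxint_dir_derive0 (F G : 'M[R]_(n, p) -> R) Y (c C : R) (a : 'I_n) (i : 'I_p) :
  0 < c -> mx_measurable F ->
  (forall M, dir_derive F (delta_mx a i) M (G M)) ->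
  (forall M, `|F M| <= C * ((1 + `|(M - Y) a i|) * gauss c (M - Y))) ->
  (forall M, `|G M| <= C * ((1 + `|(M - Y) a i|) * gauss c (M - Y))) ->
  mxintegrable G /\ mxint G = 0.
Proof.
move=> c0 mF FG Fb Gb.
have C0 : 0 <= C.
  have := le_trans (normr_ge0 _) (Fb 0); rewrite pmulr_lge0//.
  by rewrite mulr_gt0 ?expR_gt0// ltr_wpDr.
have mG := mx_measurable_dir_derive mF FG.
pose B := C * (2 * expR ((1 + 2 * c) ^+ 2 / (2 * c))).
pose g M := B * gauss (c / 2) (M - Y).
have ig : mxintegrable g by apply: mxintegrableZ; apply: mxintegrable_gauss; rewrite divr_gt0.
have bound (H : 'M[R]_(n, p) -> R) : (forall M, `|H M| <= C * ((1 + `|(M - Y) a i|) *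
  gauss c (M - Y))) ->
    forall t M, -1 < t < 1 -> `|H (M + (1 * t) *: delta_mx a i)| <= g M.
  move=> Hb t M t1; rewrite mul1r (le_trans (Hb _))// /g /B -mulrA ler_wpM2l// addrAC.
  by apply: gauss_shift_bound; rewrite // ler_norml; case/andP: t1 => /ltW-> /ltW->.
have t01 : -1 < (0:R) < 1 by rewrite ltrN10 ltr01.
have h00 M : M + (1 * 0) *: delta_mx a i = M by rewrite mulr0 scale0r addr0.
have mH (H : 'M[R]_(n, p) -> R) t : mx_measurable H -> mx_measurable (fun M => H (M + (1
  * t) *: delta_mx a i)).
  move=> mH; apply: mx_measurable_ext (mx_measurable_shift1 ((1 * t) *: delta_mx a i) mH) => M.
  by rewrite addrC.
split.
  apply: mxintegrable_le mG _ ig => M; have := bound _ Gb 0 M t01; by rewrite h00.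
have := @is_derive_mxint (fun t M => F (M + (1 * t) *: delta_mx a i))
  (fun t M => 1 * G (M + (1 * t) *: delta_mx a i)) g (-1) 1 0 t01.
have -> : (fun t => mxint (fun M => F (M + (1 * t) *: delta_mx a i))) = fun=> mxint F.
  apply/funext => t; rewrite -[RHS](mxint_shift ((1 * t) *: delta_mx a i))//.
  by congr mxint; apply/funext => M; rewrite addrC.
have -> : (fun M => 1 * G (M + (1 * 0) *: delta_mx a i)) = G.
  by apply/funext => M; rewrite mul1r h00.
move=> H; have {H}[_ <-] : is_derive (0 : R) 1 (fun=> mxint F) (mxint G).
  apply: H => //.
  - by move=> t; exact: mH.
  - move=> t tt; exact: (mxintegrable_le (mH F t mF) (fun M => bound _ Fb t M tt) ig).
  - by move=> t M tt; exact: dir_derive_at.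
  - by move=> t M tt; rewrite mul1r; exact: bound.
by rewrite derive_cst.
Qed.

End MatrixSpace.

(** * Gaussian convolutions *)

Section GaussianConvolution.
Context (R : realType) (n p : nat) d (T : measurableType d).
Variables (mu : {sigma_finite_measure set T -> \bar R}) (ev : T -> 'M[R]_(n, p)).
Hypothesis mev : forall a i, measurable_fun setT (fun v => ev v a i).
Hypothesis matintE : forall f, mx_measurable f -> (forall M, (0 <= f M)%E) ->
  matint f = (\int[mu]_v f (ev v))%E.
Implicit Types (f g dg : 'M[R]_(n, p) -> R) (M W Y : 'M[R]_(n, p)).
Variable N : R.
Hypothesis N0 : 0 < N.

Local Notation mxint := (mx_Rintegral mu ev).
Local Notation mxintegrable := (mx_integrable mu ev).
Local Notation phi := (lik N (0 : 'M[R]_(n, p))).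

(** A zero integral would make the whole space negligible, and then the likelihood could not have
    mass 1. *)
Lemma mxint_gt0 (f : 'M[R]_(n, p) -> R) : mx_measurable f -> (forall M, 0 < f M) ->
  (0 < \int[mu]_v (f (ev v))%:E)%E.
Proof.
move=> mf f0; rewrite lt_def integral_ge0 ?andbT; last first.
  by move=> v _; rewrite lee_fin ltW.
apply/eqP => f00.
have mf' := measurable_mxint_fun mev mf.
have /(ae_eq_integral_abs mu measurableT mf') fae :
    (\int[mu]_v `|(f (ev v))%:E| = 0)%E.
  by rewrite -[RHS]f00; apply: eq_integral => v _; rewrite gee0_abs// lee_fin ltW.
have := mxint_lik matintE (0 : 'M[R]_(n, p)) N0.
rewrite (@ae_eq_integral _ _ _ mu setT (cst 0%E))//.
- by rewrite integral0 => /eqP; rewrite eq_sym onee_eq0.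
- by apply: (measurable_mxint_fun mev); exact: mx_measurable_lik.
- apply: filterS fae => v /(_ I) /eqP; rewrite eqe => /eqP fv _.
  by have := f0 (ev v); rewrite fv ltxx.
Qed.

(** The scale [s] interpolates between [g] itself at 0 and its full Gaussian convolution at 1. *)
Definition gauss_conv s g Y : R := mxint (fun Z => phi Z * g (Y + s *: Z)).

Local Notation conv := gauss_conv.

Section Bounded.
Variables (g : 'M[R]_(n, p) -> R) (B : R).
Hypotheses (mg : mx_measurable g) (gB : forall M, `|g M| <= B).

Lemma mx_measurable_phiM s Y : mx_measurable (fun Z => phi Z * g (Y + s *: Z)).
Proof.
by apply: mx_measurableM; [exact: mx_measurable_lik|exact: mx_measurable_shift].
Qed.

Lemma phiM_le s Y Z : `|phi Z * g (Y + s *: Z)| <= B * phi Z.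
Proof. by rewrite normrM gtr0_norm ?lik_gt0// mulrC ler_wpM2r// ltW// lik_gt0. Qed.

Lemma mxintegrable_phiM s Y : mxintegrable (fun Z => phi Z * g (Y + s *: Z)).
Proof.
apply: (mxintegrable_le mev (mx_measurable_phiM s Y) (phiM_le s Y)).
apply: mxintegrableZ; exact: (mxintegrable_lik mev matintE).
Qed.

Lemma mx_measurable_conv s : mx_measurable (conv s g).
Proof.
have mpos (q : 'M[R]_(n, p) -> R) : mx_measurable q -> (forall M, 0 <= q M) ->
    mx_measurable (fun Y => (\int[mu]_v (phi (ev v) * q (Y + s *: ev v))%:E)%E).
  move=> mq q0 d' U e me.
  apply: (measurable_fun_fubini_tonelli_F (m2 := mu)
    (fun z : U * T => (phi (ev z.2) * q (e z.1 + s *: ev z.2))%:E)); last first.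
    by move=> z; rewrite lee_fin mulr_ge0// ltW// lik_gt0.
  apply/measurable_EFinP; apply: measurable_funM.
    apply: (@mx_measurable_lik _ _ _ N 0) => a i.
    by apply: measurableT_comp (mev a i) _ => //; exact: measurable_snd.
  apply: mq => a i; under eq_fun do rewrite !mxE.
  apply: measurable_funD.
    by apply: measurableT_comp (me a i) _ => //; exact: measurable_fst.
  apply: measurable_funM => //.
  by apply: measurableT_comp (mev a i) _ => //; exact: measurable_snd.
(* Measurability of a partial integral is available for nonnegative integrands, so [g] is split into
   its two parts. *)
pose gp M := Num.max (g M) 0; pose gn M := Num.max (- g M) 0.
have mgp : mx_measurable gp.
  by move=> d' U e me; apply: measurable_maxr; [exact: mg|exact: measurable_cst].
have mgn : mx_measurable gn.
  move=> d' U e me; apply: measurable_maxr; last exact: measurable_cst.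
  exact: (mx_measurableN mg).
have B0 : 0 <= B by apply: le_trans (gB 0); exact: normr_ge0.
have gpB M : `|gp M| <= B.
  rewrite ger0_norm ?le_max ?lexx ?orbT// ge_max B0 andbT.
  by apply: le_trans (gB M); exact: ler_norm.
have gnB M : `|gn M| <= B.
  rewrite ger0_norm ?le_max ?lexx ?orbT// ge_max B0 andbT.
  by apply: le_trans (gB M); rewrite -normrN ler_norm.
have iq (q : 'M[R]_(n, p) -> R) : mx_measurable q -> (forall M, `|q M| <= B) -> forall Y,
    mxintegrable (fun Z => phi Z * q (Y + s *: Z)).
  move=> mq qB Y; apply: (mxintegrable_le mev (g := fun Z => B * phi Z)).
  - by apply: mx_measurableM; [exact: mx_measurable_lik|exact: mx_measurable_shift].
  - by move=> Z; rewrite normrM gtr0_norm ?lik_gt0// mulrC ler_wpM2r// ltW// lik_gt0.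
  - by apply: mxintegrableZ; exact: (mxintegrable_lik mev matintE).
have E Y : conv s g Y = conv s gp Y - conv s gn Y.
  rewrite /gauss_conv -[X in _ - X]mul1r -mulNr -mxintZ; last exact: iq.
  rewrite -mxintD; last 2 first.
  - exact: iq.
  - by apply: mxintegrableZ; exact: iq.
  congr mxint; apply/funext => Z; rewrite -[LHS]/(phi Z * g (Y + s *: Z)) mulN1r -mulrBr;
    congr (_ * _).
  rewrite /gp /gn; set x := g _.
  by case: (lerP x 0) => x0; case: (lerP (- x) 0) => x1; lra.
apply: mx_measurable_ext E _; apply: mx_measurableD; last apply: mx_measurableN.
  move=> d' U e me; apply: (measurableT_comp (fine_measurable measurableT)).
  by apply: (mpos gp) => // M; rewrite le_max lexx orbT.
move=> d' U e me; apply: (measurableT_comp (fine_measurable measurableT)).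
by apply: (mpos gn) => // M; rewrite le_max lexx orbT.
Qed.

Variables (dg : 'M[R]_(n, p) -> R) (B' : R) (a : 'I_n) (i : 'I_p).
Hypotheses (gd : forall M, dir_derive g (delta_mx a i) M (dg M))
           (dgB : forall M, `|dg M| <= B').

Lemma dir_derive_conv Y : dir_derive (conv 1 g) (delta_mx a i) Y (conv 1 dg Y).
Proof.
have t01 : -1 < (0:R) < 1 by rewrite ltrN10 ltr01.
have mdg := mx_measurable_dir_derive mg gd.
have := @is_derive_mxint _ _ _ _ _ mu ev
  (fun t Z => phi Z * g (Y + t *: delta_mx a i + 1 *: Z))
  (fun t Z => phi Z * dg (Y + t *: delta_mx a i + 1 *: Z))
  (fun Z => B' * phi Z) (-1) 1 0 t01.
rewrite /dir_derive /gauss_conv scale0r addr0; apply => //.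
- move=> t; exact: mx_measurable_phiM.
- by move=> t _; exact: mxintegrable_phiM.
- move=> t Z _; apply: is_derive1Mc.
  have := dir_derive_at (Y + 1 *: Z) 1 t gd; rewrite !mul1r addrAC.
  by apply: is_derive_ext => s; rewrite mul1r addrAC.
- by move=> t Z _; rewrite normrM gtr0_norm ?lik_gt0// mulrC ler_wpM2r// ltW// lik_gt0.
- by apply: mxintegrableZ; exact: (mxintegrable_lik mev matintE).
Qed.

(** Gaussian integration by parts: [G] below is the derivative of [F] along the entry [(a, i)], its
    first term coming from the density and its second from [g]; its integral vanishes. *)
Lemma conv_ibp s Y :
  mxintegrable (fun Z => phi Z * (Z a i * g (Y + s *: Z))) /\
  mxint (fun Z => phi Z * (Z a i * g (Y + s *: Z))) = s / N * conv s dg Y.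
Proof.
have mdg := mx_measurable_dir_derive mg gd.
pose F Z := phi Z * g (Y + s *: Z).
pose G Z := - N * (phi Z * (Z a i * g (Y + s *: Z))) + s * (phi Z * dg (Y + s *: Z)).
have B0 : 0 <= B by apply: le_trans (gB 0); exact: normr_ge0.
have B'0 : 0 <= B' by apply: le_trans (dgB 0); exact: normr_ge0.
have FG M : dir_derive F (delta_mx a i) M (G M).
  have h1 := dir_derive_lik N 0 (delta_mx a i) M.
  have h2 : dir_derive (fun Z => g (Y + s *: Z)) (delta_mx a i) M (s * dg (Y + s *: M)).
    have := dir_derive_at (Y + s *: M) s 0 gd.
    rewrite mulr0 scale0r addr0; apply: is_derive_ext => t.
    by rewrite scalerDr scalerA addrA.
  have := is_derive1M h1 h2; rewrite scale0r addr0 subr0 mxdot_delta /G.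
  by congr (is_derive _ _ _ _); ring.
have N20 : 0 < N / 2 by rewrite divr_gt0.
(* One constant for both functions: [B] bounds the factor in [F], while [N * B] and [|s| * B'] bound
   the two terms of [G]. *)
pose C := lik_peak n p N * (B + N * B + `|s| * B').
have bnd x y M : x <= (B + N * B + `|s| * B') * y -> phi M * x <= C * (y * gauss (N / 2)
  (M - 0)).
  move=> xy; rewrite lik_gauss /C -!mulrA ler_pM2l ?lik_peak_gt0//.
  by rewrite subr0 mulrC mulrA ler_pM2r ?expR_gt0.
have [] := @mxint_dir_derive0 _ _ _ _ _ mu ev mev matintE F G 0 (N / 2) C a i N20 _ FG.
- exact: mx_measurable_phiM.
- move=> M; rewrite normrM gtr0_norm ?lik_gt0//; apply: bnd; rewrite subr0.
  have sB : 0 <= `|s| * B' by rewrite mulr_ge0.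
  have NB := mulr_ge0 (ltW N0) B0.
  have := mulr_ge0 (addr_ge0 (addr_ge0 B0 NB) sB) (normr_ge0 (M a i)).
  have := gB (Y + s *: M); lra.
- move=> M.
  rewrite /G [X in `|X|](_ : _ = phi M * (- N * (M a i * g (Y + s *: M)) + s * dg (Y + s
    *: M))); last by ring.
  rewrite normrM gtr0_norm ?lik_gt0//; apply: bnd; rewrite subr0.
  rewrite (le_trans (ler_normD _ _))// !normrM normrN (gtr0_norm N0).
  have := gB (Y + s *: M); have := dgB (Y + s *: M); have := normr_ge0 (M a i); have :=
    normr_ge0 s.
  move: `|M a i| `|s| `|g _| `|dg _| (normr_ge0 (g (Y + s *: M))) (normr_ge0 (dg (Y + s
    *: M))) => x u y z y0 z0 u0 x0 zB yB.
  have h1 : N * (x * y) <= N * B * x by rewrite -mulrA ler_pM2l// mulrC ler_wpM2r.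
  have h2 : u * z <= u * B' by rewrite ler_wpM2l.
  have h3 : 0 <= u * B' by rewrite mulr_ge0.
  have h4 : 0 <= N * B by rewrite mulr_ge0// ltW.
  have := mulr_ge0 h3 x0; have := mulr_ge0 B0 x0; lra.
move=> iG G0.
have iH : mxintegrable (fun Z => phi Z * dg (Y + s *: Z)).
  apply: (mxintegrable_le mev (g := fun Z => B' * phi Z)).
  - by apply: mx_measurableM; [exact: mx_measurable_lik|exact: mx_measurable_shift].
  - by move=> Z; rewrite normrM gtr0_norm ?lik_gt0// mulrC ler_wpM2r// ltW// lik_gt0.
  - by apply: mxintegrableZ; exact: (mxintegrable_lik mev matintE).
have E Z : phi Z * (Z a i * g (Y + s *: Z)) = - N^-1 * G Z + s / N * (phi Z * dg (Y + s *: Z)).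
  by rewrite /G; field; rewrite gt_eqF.
have -> : (fun Z => phi Z * (Z a i * g (Y + s *: Z))) =
  fun Z => - N^-1 * G Z + s / N * (phi Z * dg (Y + s *: Z)) by apply/funext.
split; first by apply: mxintegrableD; exact: mxintegrableZ.
rewrite mxintD ?mxintZ ?G0 ?mulr0 ?add0r//; exact: mxintegrableZ.
Qed.

End Bounded.

End GaussianConvolution.

(** * Bayes estimators for smooth superharmonic priors *)

(* [D] is the gradient of [q] and [H] the diagonal of its Hessian. *)
Record superharmonic (R : realType) (n p : nat) (q : 'M[R]_(n, p) -> R)
    (D H : 'M[R]_(n, p) -> 'M[R]_(n, p)) (B C : R) : Prop := Superharmonic {
  sh_measurable : mx_measurable q;
  sh_gt0 : forall M, 0 < q M;
  sh_le : forall M, q M <= B;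
  sh_C_ge0 : 0 <= C;
  sh_grad : forall W M, dir_derive q W M (mxdot (D M) W);
  sh_hess : forall a i M, dir_derive (fun M => D M a i) (delta_mx a i) M (H M a i);
  sh_grad_le : forall a i M, `|D M a i| <= C * q M;
  sh_hess_le : forall a i M, `|H M a i| <= C * q M;
  sh_laplacian : forall M, \sum_(a < n) \sum_(i < p) H M a i <= 0 }.

(** The arithmetic that dominates the divergence in the risk bound: [x] is the size of an entry of
    [Y - X], [z] that of the entry plus [r] times the score, and [g], [g'] are Gaussians of rates
    [N / 2] and [N / 4]. *)
Lemma drift_bound (R : realFieldType) (N C r E x z g g' : R) :
  0 < N -> 0 <= C -> 0 <= r -> 1 <= E -> 0 <= x -> 0 <= g ->
  x * g <= E * g' -> g <= g' -> z <= (1 + r * C) * (1 + x) ->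
  (N * (x * z) + (1 + r * (C + C ^+ 2))) * g <=
  ((1 + N) * (1 + r * C) + 1 + r * (C + C ^+ 2)) * E * ((1 + x) * g').
Proof.
move=> N0 C0 r0 E1 x0 g0 xg gg' zx.
have N0' := ltW N0.
have rC : 0 <= 1 + r * C by rewrite addr_ge0// mulr_ge0.
have W0 : 0 <= 1 + r * (C + C ^+ 2) by rewrite addr_ge0// mulr_ge0// addr_ge0// sqr_ge0.
have g'0 : 0 <= g' by exact: le_trans gg'.
have h1 : N * (x * z) * g <= N * (1 + r * C) * (1 + x) * (E * g').
  apply: (@le_trans _ _ (N * (1 + r * C) * (1 + x) * (x * g))); last first.
    by rewrite ler_wpM2l// mulr_ge0 ?(addr_ge0 ler01 x0)// mulr_ge0// ltW.
  rewrite (_ : N * (x * z) * g = N * (x * g) * z); last by ring.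
  rewrite (_ : N * (1 + r * C) * (1 + x) * (x * g) = N * (x * g) * ((1 + r * C) * (1 +
    x))); last by ring.
  by rewrite ler_wpM2l// !mulr_ge0.
have h2 : (1 + r * (C + C ^+ 2)) * g <= (1 + r * (C + C ^+ 2)) * (E * ((1 + x) * g')).
  rewrite ler_wpM2l//; apply: le_trans gg' _; rewrite mulrA ler_peMl//.
  by rewrite mulr_ege1// lerDl.
have h3 : 0 <= (1 + r * C) * ((1 + x) * (E * g')).
  have E0 : 0 <= E by exact: le_trans E1.
  exact: mulr_ge0 rC (mulr_ge0 (addr_ge0 ler01 x0) (mulr_ge0 E0 g'0)).
rewrite mulrDl; lra.
Qed.

Section SuperharmonicPrior.
Context (R : realType) (n p : nat) d (T : measurableType d).
Variables (mu : {sigma_finite_measure set T -> \bar R}) (ev : T -> 'M[R]_(n, p)).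
Hypothesis mev : forall a i, measurable_fun setT (fun v => ev v a i).
Hypothesis matintE : forall f, mx_measurable f -> (forall M, (0 <= f M)%E) ->
  matint f = (\int[mu]_v f (ev v))%E.
Variable N : R.
Hypothesis N0 : 0 < N.
Variables (q : 'M[R]_(n, p) -> R) (D H : 'M[R]_(n, p) -> 'M[R]_(n, p)) (B C : R).
Hypothesis shq : superharmonic q D H B C.
Implicit Types (M W Y Z : 'M[R]_(n, p)).

Local Notation mxint := (mx_Rintegral mu ev).
Local Notation mxintegrable := (mx_integrable mu ev).
Local Notation conv := (gauss_conv mu ev N).
Local Notation phi := (lik N (0 : 'M[R]_(n, p))).

Let mq := sh_measurable shq.
Let qB M : `|q M| <= B. Proof. by rewrite gtr0_norm ?(sh_gt0 shq)// (sh_le shq). Qed.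
Let C0 : 0 <= C. Proof. exact: (sh_C_ge0 shq). Qed.
Let B0 : 0 <= B. Proof. by apply: le_trans (qB 0); exact: normr_ge0. Qed.
Let qd a i M : dir_derive q (delta_mx a i) M (D M a i).
Proof. by have := sh_grad shq (delta_mx a i) M; rewrite mxdot_delta. Qed.
Let mD a i : mx_measurable (fun M => D M a i).
Proof. exact: mx_measurable_dir_derive mq (@qd a i). Qed.
Let mH a i : mx_measurable (fun M => H M a i).
Proof. exact: mx_measurable_dir_derive (mD a i) (@sh_hess _ _ _ _ _ _ _ _ shq a i). Qed.
Let DB a i M : `|D M a i| <= C * B.
Proof. by apply: le_trans (sh_grad_le shq a i M) _; rewrite ler_wpM2l// (sh_le shq). Qed.
Let HB a i M : `|H M a i| <= C * B.
Proof. by apply: le_trans (sh_hess_le shq a i M) _; rewrite ler_wpM2l// (sh_le shq). Qed.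

Lemma mxintegrable_abs_coef a i : mxintegrable (fun Z => phi Z * `|Z a i|).
Proof.
have N20 : 0 < N / 2 by rewrite divr_gt0.
have N40 : 0 < N / 2 / 2 by rewrite divr_gt0.
apply: (mxintegrable_le mev (g := fun Z => lik_peak n p N * expR (1 ^+ 2 / (2 * (N / 2)))
  * gauss (N / 2 / 2) (Z - 0))).
- apply: mx_measurableM; first exact: mx_measurable_lik.
  by apply: (mx_measurable_comp (h := Num.norm)); [exact: normr_measurable|exact:
    mx_measurable_coef].
- move=> Z; rewrite normrM gtr0_norm ?lik_gt0// normr_id lik_gauss !subr0 -[leLHS]mulrA
    -[leRHS]mulrA ler_pM2l ?lik_peak_gt0//.
  apply: le_trans (gauss_absorb 1 Z a i N20); rewrite mulrC ler_wpM2r ?expR_ge0// mul1r.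
  by have := expR_ge1Dx `|Z a i|; lra.
- by apply: mxintegrableZ; exact: mxintegrable_gauss.
Qed.

Lemma conv_laplacian_le0 s Y :
  \sum_(a < n) \sum_(i < p) conv s (fun M => H M a i) Y <= 0.
Proof.
have iH a i := mxintegrable_phiM mev matintE N0 (mH a i) (HB a i) s Y.
have [iS ES] : mxintegrable (fun Z => \sum_(a < n) \sum_(i < p) phi Z * H (Y + s *: Z) a i) /\
  mxint (fun Z => \sum_(a < n) \sum_(i < p) phi Z * H (Y + s *: Z) a i) =
  \sum_(a < n) mxint (fun Z => \sum_(i < p) phi Z * H (Y + s *: Z) a i).
  by apply: mxint_sum => a; exact: (mxint_sum (index_enum 'I_p) (h := fun i Z => phi Z *
    H (Y + s *: Z) a i) (iH a)).1.
have -> : \sum_(a < n) \sum_(i < p) conv s (fun M => H M a i) Y =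
    mxint (fun Z => \sum_(a < n) \sum_(i < p) phi Z * H (Y + s *: Z) a i).
  rewrite ES; apply: eq_bigr => a _.
  by have [_ ->] := mxint_sum (index_enum 'I_p) (h := fun i Z => phi Z * H (Y + s *: Z) a
    i) (iH a).
rewrite -[leRHS](mul0r (mxint phi)) -mxintZ; last exact: (mxintegrable_lik mev matintE).
apply: le_mxint => //.
  by apply: mxintegrableZ; exact: (mxintegrable_lik mev matintE).
move=> Z; rewrite mul0r.
under eq_bigr do rewrite -mulr_sumr.
by rewrite -mulr_sumr mulr_ge0_le0 ?(sh_laplacian shq)// ltW// lik_gt0.
Qed.

(** The heat equation in the scale variable: differentiating under the integral gives the mean of
    [mxdot (D (Y + s *: Z)) Z], and integration by parts turns each factor [Z a i] into [s / N]
    times a second derivative. The open interval leaves room around the endpoints 0 and 1. *)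
Lemma is_derive_conv_scale (s : R) Y : -1 < s < 2 ->
  is_derive s 1 (fun s => conv s q Y)
    (s / N * \sum_(a < n) \sum_(i < p) conv s (fun M => H M a i) Y).
Proof.
move=> s12.
have iD a i := conv_ibp mev matintE N0 (mD a i) (DB a i) (@sh_hess _ _ _ _ _ _ _ _ shq a
  i) (HB a i) s Y.
have -> : s / N * (\sum_(a < n) \sum_(i < p) conv s (fun M => H M a i) Y) =
    mxint (fun Z => phi Z * mxdot (D (Y + s *: Z)) Z).
  have -> : (fun Z => phi Z * mxdot (D (Y + s *: Z)) Z) =
      fun Z => \sum_(a < n) \sum_(i < p) phi Z * (Z a i * D (Y + s *: Z) a i).
    apply/funext => Z; rewrite mulr_sumr; apply: eq_bigr => a _.
    by rewrite mulr_sumr; apply: eq_bigr => i _; rewrite [D _ _ _ * _]mulrC.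
  have h a := mxint_sum (index_enum 'I_p) (h := fun i Z => phi Z * (Z a i * D (Y + s *:
    Z) a i))
    (fun i => (iD a i).1).
  have [_ ->] := mxint_sum (index_enum 'I_n) (h := fun a Z => \sum_(i < p) phi Z * (Z a i
    * D (Y + s *: Z) a i))
    (fun a => (h a).1).
  rewrite mulr_sumr; apply: eq_bigr => a _; rewrite (h a).2 mulr_sumr.
  by apply: eq_bigr => i _; rewrite (iD a i).2.
pose g Z := \sum_(a < n) \sum_(i < p) C * B * (phi Z * `|Z a i|).
apply: (@is_derive_mxint _ _ _ _ _ mu ev (fun s Z => phi Z * q (Y + s *: Z))
  (fun s Z => phi Z * mxdot (D (Y + s *: Z)) Z) g (-1) 2 s s12).
- by move=> t; exact: mx_measurable_phiM.
- move=> t _; exact: (mxintegrable_phiM mev matintE N0 mq qB).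
- move=> t Z _; apply: is_derive1Mc.
  have h := dir_derive_at Y 1 t (fun M => sh_grad shq Z M).
  by move: h; rewrite !mul1r; apply: is_derive_ext => x; rewrite mul1r.
- move=> t Z _; rewrite normrM gtr0_norm ?lik_gt0// /g.
  under eq_bigr => a _.
    under eq_bigr => i _ do rewrite mulrCA.
    rewrite -mulr_sumr.
  over.
  rewrite -mulr_sumr ler_pM2l ?lik_gt0//.
  apply: le_trans (ler_norm_sum _ _ _) _; apply: ler_sum => a _.
  apply: le_trans (ler_norm_sum _ _ _) _; apply: ler_sum => i _.
  by rewrite normrM ler_wpM2r.
- apply: (mxint_sum _ _).1 => a; apply: (mxint_sum _ _).1 => i.
  by apply: mxintegrableZ; exact: mxintegrable_abs_coef.
Qed.

Lemma conv1_le Y : conv 1 q Y <= q Y.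
Proof.
have hd s : -1 < s < 2 -> _ := @is_derive_conv_scale s Y.
have -> : q Y = conv 0 q Y.
  rewrite /gauss_conv; under [X in mxint X]eq_fun do rewrite scale0r addr0 mulrC.
  by rewrite mxintZ ?(mxint_lik1 matintE) ?mulr1//; exact: (mxintegrable_lik mev matintE).
apply: (@ler0_derive1_nincr R (fun s => conv s q Y) 0 1) => //.
- by move=> s; rewrite in_itv/= => s01; have [] := hd s ltac:(lra).
- move=> s; rewrite in_itv/= => s01; rewrite derive1E; have [_ ->] := hd s ltac:(lra).
  rewrite mulr_ge0_le0 ?conv_laplacian_le0// divr_ge0 ?(ltW N0)//; lra.
- apply: derivable_within_continuous => s; rewrite in_itv/= => s01.
  by have [] := hd s ltac:(lra).
Qed.


(** Bounds relative to [q] pass to the convolution with the same constant; applied to [D] and [H],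
    this bounds [G] and [L] below. *)
Lemma conv_le_conv (g : 'M[R]_(n, p) -> R) Y : mx_measurable g -> (forall M, `|g M| <= C
  * q M) ->
  `|conv 1 g Y| <= C * conv 1 q Y.
Proof.
move=> mg gC.
have gB M : `|g M| <= C * B by apply: le_trans (gC M) _; rewrite ler_wpM2l// (sh_le shq).
have ig := mxintegrable_phiM mev matintE N0 mg gB 1 Y.
have iq := mxintegrable_phiM mev matintE N0 mq qB 1 Y.
apply: le_trans (le_normr_Rintegral measurableT ig) _.
rewrite -mxintZ//; apply: le_Rintegral => //.
- by have := integrable_norm ig.
- exact: (mxintegrableZ C iq).
- by move=> v _; rewrite normrM gtr0_norm ?lik_gt0// mulrCA ler_pM2l ?lik_gt0.
Qed.

Let m := conv 1 q.
(** [G] is the gradient of [ln m]; [L] holds the pure second derivatives of [m] divided by [m], so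
    that [G a i] has derivative [L a i - (G a i)^2] along its own entry. *)
Let G a i Y := conv 1 (fun M => D M a i) Y / m Y.
Let L a i Y := conv 1 (fun M => H M a i) Y / m Y.

Let m_gt0 Y : 0 < m Y.
Proof.
have h := mxint_gt0 mev matintE N0 (mx_measurable_phiM N mq 1 Y)
  (fun Z => mulr_gt0 (lik_gt0 0 Z N0) (sh_gt0 shq (Y + 1 *: Z))).
apply: fine_gt0; rewrite h/=.
have /integrableP[_] := mxintegrable_phiM mev matintE N0 mq qB 1 Y.
apply: le_lt_trans; rewrite le_eqVlt; apply/orP; left; apply/eqP.
apply: eq_integral => v _; rewrite gee0_abs// lee_fin ltW// mulr_gt0 ?lik_gt0//.
exact: (sh_gt0 shq).
Qed.

Let G_le a i Y : `|G a i Y| <= C.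
Proof.
rewrite normf_div (gtr0_norm (m_gt0 Y)) ler_pdivrMr//.
by apply: conv_le_conv; [exact: mD|exact: (sh_grad_le shq)].
Qed.

Let L_le a i Y : `|L a i Y| <= C.
Proof.
rewrite normf_div (gtr0_norm (m_gt0 Y)) ler_pdivrMr//.
by apply: conv_le_conv; [exact: mH|exact: (sh_hess_le shq)].
Qed.

Let G_derive a i Y : dir_derive (G a i) (delta_mx a i) Y (L a i Y - G a i Y ^+ 2).
Proof.
have h1 := dir_derive_conv mev matintE N0 (mD a i) (DB a i) (@sh_hess _ _ _ _ _ _ _ _ shq
  a i) (HB a i) Y.
have h2 := dir_derive_conv mev matintE N0 mq qB (@qd a i) (DB a i) Y.
have mY : m (Y + 0 *: delta_mx a i) != 0 by rewrite gt_eqF.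
have := is_derive1M h1 (is_derive1V mY h2); rewrite scale0r addr0 -/m.
congr (is_derive _ _ _ _); rewrite /G /L; field.
by rewrite gt_eqF.
Qed.

Let mG a i : mx_measurable (G a i).
Proof.
apply: mx_measurableM; first exact: (mx_measurable_conv mev matintE N0 (mD a i) (DB a i)).
apply: mx_measurableV => [Y|]; first exact: ltW.
exact: (mx_measurable_conv mev matintE N0 mq qB).
Qed.

Definition post_mean Y : 'M[R]_(n, p) := \matrix_(a, i)
  (mxint (fun M => M a i * lik N Y M * q M) / mxint (fun M => lik N Y M * q M)).

Let lik_shift_phi Y Z : lik N Y (Y + Z) = phi Z.
Proof. by rewrite -(lik_shift N 0 Y Z) add0r addrC. Qed.

Lemma mxintegrable_lik_prior Y : mxintegrable (fun M => lik N Y M * q M).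
Proof.
apply: (mxintegrable_le mev (g := fun M => B * lik N Y M)).
- by apply: mx_measurableM => //; exact: mx_measurable_lik.
- by move=> M; rewrite normrM gtr0_norm ?lik_gt0// mulrC ler_wpM2r// ltW// lik_gt0.
- by apply: mxintegrableZ; exact: (mxintegrable_lik mev matintE).
Qed.

Lemma mxint_lik_prior Y : mxint (fun M => lik N Y M * q M) = conv 1 q Y.
Proof.
rewrite -(mxint_shift matintE Y).
  by congr (mx_Rintegral _ _ _); apply/funext => Z; rewrite lik_shift_phi scale1r.
by apply: mx_measurableM => //; exact: mx_measurable_lik.
Qed.

(** Tweedie's formula. The substitution [M = Y + Z] turns the numerator into [Y a i * m Y] plus the
    mean of [Z a i * q (Y + Z)], to which integration by parts applies. *)
Lemma post_meanE a i Y : post_mean Y a i = Y a i + G a i Y / N.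
Proof.
have iq := mxintegrable_phiM mev matintE N0 mq qB 1 Y.
have [iz Ez] := conv_ibp mev matintE N0 mq qB (@qd a i) (DB a i) 1 Y.
rewrite mxE mxint_lik_prior -/m.
have -> : mxint (fun M => M a i * lik N Y M * q M) = Y a i * m Y + N^-1 * conv 1 (fun M
  => D M a i) Y.
  rewrite -(mxint_shift matintE Y); last first.
    apply: mx_measurableM => //; apply: mx_measurableM; first exact: mx_measurable_coef.
    exact: mx_measurable_lik.
  rewrite mul1r in Ez; rewrite -Ez /m /gauss_conv -mxintZ// -mxintD//; last exact:
    mxintegrableZ.
  congr (mx_Rintegral _ _ _); apply/funext => Z; rewrite lik_shift_phi scale1r mxE; ring.
rewrite /G; field; by rewrite !gt_eqF.
Qed.

Lemma mx_measurable_post_mean a i : mx_measurable (fun Y => post_mean Y a i).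
Proof.
apply: (mx_measurable_ext (f := fun Y => Y a i + N^-1 * G a i Y)) => [Y|].
  by rewrite post_meanE [N^-1 * _]mulrC.
apply: mx_measurableD; first exact: mx_measurable_coef.
by apply: mx_measurableM; [exact: mx_measurable_cst|exact: mG].
Qed.

Lemma mx_measurable_loss X :
  mx_measurable (fun Y => lik N X Y * frob2 (post_mean Y - X)).
Proof.
apply: mx_measurableM; first exact: mx_measurable_lik.
apply: (mx_measurable_affine (f := @frob2 R n p) (A := fun Y => post_mean Y - X)); last first.
  exact: mx_measurable_frob2.
move=> a i; apply: (mx_measurable_ext (f := fun Y => post_mean Y a i + (- X a i))).
  by move=> Y; rewrite [LHS]mxE [X in _ + X = _]mxE.
by apply: mx_measurableD; [exact: mx_measurable_post_mean|exact: mx_measurable_cst].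
Qed.

(** One field [F] serves the whole of Stein's identity: its part [Y - X] produces the variance
    [np/N] and its part [2 / N * G] the cross term. Pointwise, the weighted loss equals [np/N * lik]
    minus [N^-1] times the divergence of [F], plus a nonpositive remainder; its integrability thus
    need not be known beforehand. *)
Theorem risk_post_mean_le X :
  (\int[mu]_v (lik N X (ev v) * frob2 (post_mean (ev v) - X))%:E <= ((n * p)%:R / N)%:E)%E.
Proof.
pose F a i Y := lik N X Y * ((Y - X) a i + 2 / N * G a i Y).
pose dF a i Y := lik N X Y *
  (- N * (Y - X) a i * ((Y - X) a i + 2 / N * G a i Y) + 1 + 2 / N * (L a i Y - G a i Y ^+ 2)).
have FdF a i Y : dir_derive (F a i) (delta_mx a i) Y (dF a i Y).
  have h1 := dir_derive_lik N X (delta_mx a i) Y.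
  have h2 : dir_derive (fun Y => (Y - X) a i) (delta_mx a i) Y 1.
    have := is_derive1_affine 1 ((Y - X) a i) 0; apply: is_derive_ext => t.
    by rewrite !mxE !eqxx mul1r mulr1; ring.
  have := is_derive1M h1 (is_derive1D h2 (is_derive1Mc (2 / N) (G_derive a i Y))).
  rewrite /= scale0r addr0 mxdot_delta.
  by congr (is_derive _ _ _ _); rewrite /dF; ring.
(* The derivative [dF] is quadratic in [Y - X], whereas [mxint_dir_derive0] allows one linear
   factor; half the Gaussian rate is spent on the other. *)
have N40 : 0 < N / 2 / 2 by rewrite !divr_gt0.
have intdF a i : mxintegrable (dF a i) /\ mxint (dF a i) = 0.
  have N20 : 0 < N / 2 by rewrite divr_gt0.
  pose E := expR (1 ^+ 2 / (2 * (N / 2))).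
  (* [K * E] is the constant of [drift_bound] with [r = 2 / N]; by [K1] it also covers the bound on
     [F]. *)
  pose K := (1 + N) * (1 + 2 / N * C) + 1 + 2 / N * (C + C ^+ 2).
  have E1 : 1 <= E by rewrite -expR0 ler_expR divr_ge0// mulr_ge0// ltW.
  have K1 : 1 + 2 / N * C <= K.
    rewrite /K; have := C0; have : 0 <= 2 / N by rewrite divr_ge0// ltW.
    move: (2 / N) => r r0 c0; have := mulr_ge0 r0 c0; have := mulr_ge0 r0 (mulr_ge0 c0 c0).
    have := mulr_ge0 (ltW N0) (mulr_ge0 r0 c0); have := N0; nra.
  have lg Y : gauss (N / 2) (Y - X) <= gauss (N / 2 / 2) (Y - X).
    rewrite ler_expR lerN2 ler_wpM2r ?frob2_ge0//; have := N0; lra.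
  have lx Y : `|(Y - X) a i| * gauss (N / 2) (Y - X) <= E * gauss (N / 2 / 2) (Y - X).
    apply: le_trans (gauss_absorb 1 (Y - X) a i N20); rewrite ler_wpM2r ?expR_ge0// mul1r.
    by have := expR_ge1Dx `|(Y - X) a i|; lra.
  have aG Y : `|(Y - X) a i + 2 / N * G a i Y| <= (1 + 2 / N * C) * (1 + `|(Y - X) a i|).
    rewrite (le_trans (ler_normD _ _))// normrM ger0_norm ?divr_ge0 ?ltW//.
    have := G_le a i Y; have : 0 <= 2 / N by rewrite divr_ge0// ltW.
    move: (2 / N) `|_ a i| (normr_ge0 ((Y - X) a i)) `|G _ _ _| => r x x0 y r0 yC.
    have : r * y <= r * C by rewrite ler_wpM2l.
    have := mulr_ge0 (mulr_ge0 r0 C0) x0; lra.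
  have bnd x Y : `|x| * gauss (N / 2) (Y - X) <= K * E * ((1 + `|(Y - X) a i|) * gauss (N
    / 2 / 2) (Y - X)) ->
     `|lik N X Y * x| <= lik_peak n p N * K * E * ((1 + `|(Y - X) a i|) * gauss (N / 2 /
       2) (Y - X)).
    move=> h; rewrite normrM gtr0_norm ?lik_gt0// lik_gauss -[leLHS]mulrA [gauss _ _ * _]mulrC.
    by rewrite -[lik_peak n p N * K * E]mulrA -[leRHS]mulrA ler_pM2l ?lik_peak_gt0//.
  apply: (@mxint_dir_derive0 _ _ _ _ _ mu ev mev matintE (F a i) (dF a i) X (N / 2 / 2)
    (lik_peak n p N * K * E) a i N40 _ (FdF a i)) => [|Y|Y].
  - apply: mx_measurableM; first exact: mx_measurable_lik.
    apply: mx_measurableD; last by apply: mx_measurableM => //; exact: mx_measurable_cst.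
    apply: (mx_measurable_ext (f := fun Y => Y a i + (- X a i))) => [Y|]; first by
      rewrite !mxE.
    by apply: mx_measurableD; [exact: mx_measurable_coef|exact: mx_measurable_cst].
  - apply: bnd; have := aG Y; have := lg Y.
    have : 0 <= gauss (N / 2) (Y - X) by exact: expR_ge0.
    have := normr_ge0 ((Y - X) a i).
    move: `|(Y - X) a i| `|(Y - X) a i + 2 / N * G a i Y| (gauss (N / 2) (Y - X)) (gauss
      (N / 2 / 2) (Y - X)) => x z g g' x0 g0 gg' zx.
    apply: (@le_trans _ _ ((1 + 2 / N * C) * (1 + x) * g)); first by rewrite ler_wpM2r.
    rewrite -mulrA ler_pM//.
    + by rewrite addr_ge0// mulr_ge0// divr_ge0// ltW.
    + by rewrite mulr_ge0// addr_ge0.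
    + by apply: (le_trans K1); rewrite ler_peMr// (le_trans _ K1)// addr_ge0// mulr_ge0//
        divr_ge0// ltW.
    + by rewrite ler_wpM2l// addr_ge0.
  - apply: bnd; have := aG Y; have := lg Y; have := lx Y.
    have : 0 <= gauss (N / 2) (Y - X) by exact: expR_ge0.
    have LG : `|L a i Y - G a i Y ^+ 2| <= C + C ^+ 2.
      rewrite (le_trans (ler_normB _ _))// lerD// normrX lerXn2r ?nnegrE//.
    have r0 : 0 <= 2 / N by rewrite divr_ge0// ltW.
    move=> g0 xg gg' zx; apply: (@le_trans _ _ ((N * (`|(Y - X) a i| * `|(Y - X) a i + 2
      / N * G a i Y|) + (1 + 2 / N * (C + C ^+ 2))) * gauss (N / 2) (Y - X))).
      rewrite ler_wpM2r ?expR_ge0// -addrA (le_trans (ler_normD _ _))// lerD//.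
        by rewrite !normrM normrN (gtr0_norm N0) -mulrA.
      by rewrite (le_trans (ler_normD _ _))// normr1 lerD2l normrM ger0_norm// ler_wpM2l.
    exact: drift_bound (normr_ge0 _) g0 xg gg' zx.
have F2 Y : lik N X Y * frob2 (post_mean Y - X) <=
    (n * p)%:R / N * lik N X Y + - N^-1 * \sum_(a < n) \sum_(i < p) dF a i Y.
  have -> : lik N X Y * frob2 (post_mean Y - X) =
    (n * p)%:R / N * lik N X Y + - N^-1 * \sum_(a < n) \sum_(i < p) dF a i Y
    + lik N X Y * (N ^- 2 * \sum_(a < n) \sum_(i < p) (2 * L a i Y - G a i Y ^+ 2)).
    have -> : (n * p)%:R / N * lik N X Y = \sum_(a < n) \sum_(i < p) (N^-1 * lik N X Y).
      by rewrite !sumr_const !card_ord -mulrnA mulnC -[RHS]mulr_natl mulrA.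
    rewrite /frob2 !mulr_sumr -!big_split; apply: eq_bigr => a _ /=.
    rewrite !mulr_sumr -!big_split; apply: eq_bigr => i _ /=.
    have -> : (post_mean Y - X) a i = (Y - X) a i + G a i Y / N.
      by rewrite [LHS]mxE post_meanE [X in _ = X + _]mxE; ring.
    rewrite /dF; move: (lik N X Y) ((Y - X) a i) (G a i Y) (L a i Y) => l x g h.
    by field; rewrite gt_eqF.
  rewrite gerDl; apply: mulr_ge0_le0; first by rewrite ltW// lik_gt0.
  apply: mulr_ge0_le0; first by rewrite invr_ge0 exprn_ge0// ltW.
  (* Dropping the squares of [G] leaves twice the Laplacian of [m] over [m]. *)
  apply: (@le_trans _ _ (2 / m Y * \sum_(a < n) \sum_(i < p) conv 1 (fun M => H M a i) Y)).
    rewrite mulr_sumr ler_sum// => a _; rewrite mulr_sumr ler_sum// => i _.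
    have -> : 2 / m Y * conv 1 (fun M => H M a i) Y = 2 * L a i Y by rewrite /L mulrA mulrAC.
    by rewrite gerBl sqr_ge0.
  by rewrite mulr_ge0_le0 ?conv_laplacian_le0// divr_ge0// ltW.
have mR := mx_measurable_loss X.
have ilik := mxintegrable_lik mev matintE X N0.
have h a := mxint_sum (index_enum 'I_p) (h := fun i Y => dF a i Y) (fun i => (intdF a i).1).
have [iS ES] := mxint_sum (index_enum 'I_n) (h := fun a Y => \sum_(i < p) dF a i Y) (fun
  a => (h a).1).
have ES0 : mxint (fun Y => \sum_(a < n) \sum_(i < p) dF a i Y) = 0.
  by rewrite ES big1// => a _; rewrite (h a).2 big1// => i _; rewrite (intdF a i).2.
have i1 := mxintegrableZ ((n * p)%:R / N) ilik.
have i2 := mxintegrableZ (- N^-1) iS.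
have i12 := mxintegrableD i1 i2.
apply: (@le_trans _ _ (\int[mu]_v ((n * p)%:R / N * lik N X (ev v) + - N^-1 * \sum_(a <
  n) \sum_(i < p) dF a i (ev v))%:E)%E).
  apply: ge0_le_integral => //.
  - by move=> v _; rewrite lee_fin mulr_ge0 ?frob2_ge0// ltW// lik_gt0.
  - exact: (measurable_mxint_fun mev mR).
  - by case/integrableP: i12.
  - by move=> v _; rewrite lee_fin.
have EU : mxint (fun Y => (n * p)%:R / N * lik N X Y + - N^-1 * \sum_(a < n) \sum_(i < p)
  dF a i Y) = (n * p)%:R / N.
  by rewrite mxintD// !mxintZ// ES0 mulr0 addr0 (mxint_lik1 matintE)// mulr1.
rewrite -[X in (_ <= X%:E)%E]EU /mx_Rintegral /Rintegral fineK//.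
exact: (integrable_fin_num measurableT i12).
Qed.

End SuperharmonicPrior.

(** * Determinants and positive definite matrices *)

Section MatrixDerivatives.
Variable R : realType.

Lemma is_derive1_prod (I : eqType) (s : seq I) (h : I -> R -> R) (dh : I -> R) (x : R) :
  uniq s -> (forall i, is_derive x 1 (h i) (dh i)) ->
  is_derive x 1 (fun t => \prod_(i <- s) h i t)
    (\sum_(i <- s) \prod_(j <- s) (if j == i then dh j else h j x)).
Proof.
move=> us hd; elim: s us => [_|i s IH /= /andP[nis us]].
  rewrite big_nil; apply: is_derive_ext (is_derive1c 1 x) => t; by rewrite big_nil.
have := is_derive1M (hd i) (IH us).
rewrite big_cons [X in _ -> is_derive _ _ _ (X + _)]big_cons eqxx.
have -> : \prod_(j <- s) (if j == i then dh j else h j x) = \prod_(j <- s) h j x.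
  by apply: eq_big_seq => j js; case: eqP => // ji; rewrite -ji js in nis.
rewrite mulr_sumr.
have -> : \sum_(j <- s) (h i x * \prod_(j0 <- s) (if j0 == j then dh j0 else h j0 x)) =
  \sum_(j <- s) \prod_(j0 <- i :: s) (if j0 == j then dh j0 else h j0 x).
  apply: eq_big_seq => j js; rewrite big_cons; case: eqP => // ij.
  by rewrite ij js in nis.
by apply: is_derive_ext => t; rewrite big_cons.
Qed.

(** Jacobi's formula. In the Leibniz expansion the product rule replaces one row [i] by its
    derivative; expanding the resulting determinant along that row gives the cofactors of [X x]. *)
Lemma is_derive_det k (X : R -> 'M[R]_k) (dX : 'M[R]_k) (x : R) :
  (forall i j, is_derive x 1 (fun t => X t i j) (dX i j)) ->
  is_derive x 1 (fun t => \det (X t)) (\tr (\adj (X x) *m dX)).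
Proof.
move=> hd.
have := is_derive1_sum (index_enum {perm 'I_k}) (fun s : {perm 'I_k} =>
  is_derive1Mc ((-1) ^+ s) (is_derive1_prod (index_enum_uniq 'I_k) (fun i => hd i (s i)))).
rewrite /determinant.
have -> // : \tr (\adj (X x) *m dX) = \sum_(s : {perm 'I_k}) (-1) ^+ s *
    \sum_i \prod_j (if j == i then dX j (s j) else X x j (s j)).
under [RHS]eq_bigr do rewrite mulr_sumr.
rewrite exchange_big/= mxtrace_mulC; apply: eq_bigr => i _.
pose Xi := \matrix_(j, l) (if j == i then dX j l else X x j l).
transitivity (\det Xi).
  rewrite (expand_det_row Xi i) mxE; apply: eq_bigr => l _; rewrite !mxE eqxx.
  congr (_ * (_ * \det _)); apply/matrixP => a b; rewrite !mxE.
  by rewrite -[_ == i]negbK eq_sym neq_lift.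
apply: eq_bigr => s _; congr (_ * _); apply: eq_bigr => j _; by rewrite mxE.
Qed.

Lemma is_derive_mulmx m k l (X : R -> 'M[R]_(m, k)) (Y : R -> 'M[R]_(k, l))
    (dX : 'M[R]_(m, k)) (dY : 'M[R]_(k, l)) (x : R) :
  (forall i j, is_derive x 1 (fun t => X t i j) (dX i j)) ->
  (forall i j, is_derive x 1 (fun t => Y t i j) (dY i j)) ->
  forall i j, is_derive x 1 (fun t => (X t *m Y t) i j) ((dX *m Y x + X x *m dY) i j).
Proof.
move=> hX hY i j; rewrite !mxE -big_split /=.
apply: is_derive_ext (is_derive1_sum (index_enum 'I_k) (fun r => is_derive1M (hX i r) (hY
  r j))) => t.
by rewrite mxE.
Qed.

(** The entries of the inverse are cofactors over the determinant, so some derivative [dT] exists;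
    differentiating [X t *m invmx (X t) = 1] then identifies it. *)
Lemma is_derive_invmx k (X : R -> 'M[R]_k) (dX : 'M[R]_k) (x : R) :
  (forall t, X t \in unitmx) ->
  (forall i j, is_derive x 1 (fun t => X t i j) (dX i j)) ->
  forall i j, is_derive x 1 (fun t => invmx (X t) i j)
    ((- (invmx (X x) *m dX *m invmx (X x))) i j).
Proof.
move=> uX hX.
have ex i j : exists l, is_derive x 1 (fun t => invmx (X t) i j) l.
  have h1 := is_derive_det hX.
  have h2 : is_derive x 1 (fun t => \det (row' j (col' i (X t)))) (\tr (\adj (row' j
    (col' i (X x))) *m row' j (col' i dX))).
    apply: is_derive_det => a b; rewrite !mxE.
    by apply: is_derive_ext (hX (lift j a) (lift i b)) => t; rewrite !mxE.
  have dn0 : \det (X x) != 0 by rewrite -unitfE -unitmxE.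
  eexists; apply: is_derive_ext (is_derive1M (is_derive1V dn0 h1) (is_derive1Mc ((-1) ^+
    (j + i)) h2)) => t.
  by rewrite /invmx uX !mxE.
have [dT hT] : exists dT : 'M[R]_k, forall i j, is_derive x 1 (fun t => invmx (X t) i j)
  (dT i j).
  pose f (i j : 'I_k) := projT1 (cid (ex i j)).
  by exists (\matrix_(i, j) f i j) => i j; rewrite mxE /f; case: cid.
suff -> : - (invmx (X x) *m dX *m invmx (X x)) = dT by [].
have E : dX *m invmx (X x) + X x *m dT = 0.
  apply/matrixP => i j; rewrite [RHS]mxE; have [_ <-] := is_derive_mulmx hX hT i j.
  have -> : (fun t => (X t *m invmx (X t)) i j) = fun=> (1%:M : 'M[R]_k) i j.
    by apply/funext => t; rewrite mulmxV.
  by rewrite derive_cst.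
move/(congr1 (mulmx (invmx (X x)))): E; rewrite mulmxDr mulKmx// mulmx0 mulmxA => /eqP.
by rewrite addrC addr_eq0 => /eqP ->.
Qed.

End MatrixDerivatives.

Section PositiveDefinite.
Variable R : realType.

Definition quadf k (X : 'M[R]_k) (v : 'rV[R]_k) : R := (v *m X *m v^T) 0 0.

Definition posdef k (X : 'M[R]_k) := X^T = X /\ forall v, v != 0 -> 0 < quadf X v.

Lemma quadf_gram m k (Z : 'M[R]_(m, k)) v :
  quadf (Z^T *m Z) v = \sum_a (v *m Z^T) 0 a ^+ 2.
Proof.
rewrite /quadf !mulmxA -mulmxA -{2}[Z]trmxK -trmx_mul mxE; apply: eq_bigr => a _.
by rewrite [_^T _ _]mxE -expr2.
Qed.

Lemma quadf_row m k (Y : 'M[R]_k) (Z : 'M[R]_(m, k)) a :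
  quadf Y (row a Z) = (Z *m Y *m Z^T) a a.
Proof.
rewrite /quadf tr_row -row_mul mxE [RHS]mxE; apply: eq_bigr => j _.
by rewrite !mxE.
Qed.

Lemma quadf_scalar k (e : R) (v : 'rV[R]_k) : quadf e%:M v = e * \sum_i v 0 i ^+ 2.
Proof.
rewrite /quadf mul_mx_scalar -scalemxAl mxE mxE; congr (_ * _); apply: eq_bigr => i _.
by rewrite mxE expr2.
Qed.

Lemma quadfD k (X Y : 'M[R]_k) v : quadf (X + Y) v = quadf X v + quadf Y v.
Proof. by rewrite /quadf mulmxDr mulmxDl mxE. Qed.

Lemma quadfZ k c (X : 'M[R]_k) v : quadf (c *: X) v = c * quadf X v.
Proof. by rewrite /quadf -scalemxAr -scalemxAl mxE. Qed.

Lemma sum_sqr_gt0 k (v : 'rV[R]_k) : v != 0 -> 0 < \sum_i v 0 i ^+ 2.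
Proof.
move=> v0; rewrite lt_def sumr_ge0 ?andbT => [|i _]; last exact: sqr_ge0.
apply: contra v0 => /eqP /psumr_eq0P h; apply/eqP/rowP => i; rewrite mxE.
by apply/eqP; rewrite -sqrf_eq0 h// => j _; exact: sqr_ge0.
Qed.

Lemma posdef_scalar k (e : R) : 0 < e -> posdef (e%:M : 'M[R]_k).
Proof.
move=> e0; split=> [|v v0]; first by rewrite tr_scalar_mx.
by rewrite quadf_scalar mulr_gt0// sum_sqr_gt0.
Qed.

Lemma posdefD_gram m k (X : 'M[R]_k) (Z : 'M[R]_(m, k)) : posdef X -> posdef (X + Z^T *m Z).
Proof.
move=> [sX pX]; split=> [|v v0]; first by rewrite linearD/= sX trmx_mul trmxK.
rewrite quadfD ltr_wpDr ?pX// quadf_gram sumr_ge0// => a _; exact: sqr_ge0.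
Qed.

Lemma posdef_unit k (X : 'M[R]_k) : posdef X -> X \in unitmx.
Proof.
move=> [_ pX]; rewrite -row_free_unit -kermx_eq0; apply/eqP/row_matrixP => i; rewrite row0.
apply/eqP; apply: contraT => /pX; rewrite /quadf -row_mul mulmx_ker row0 mul0mx mxE ltxx.
by [].
Qed.

(** The segment from the identity to [X] consists of positive definite, hence invertible, matrices;
    by the intermediate value theorem the determinant keeps the sign it has at the identity. *)
Lemma posdef_det_gt0 k (X : 'M[R]_k) : posdef X -> 0 < \det X.
Proof.
move=> pX; pose P (t : R) := (1 - t) *: (1%:M : 'M[R]_k) + t *: X.
have hd (t : R) : is_derive t 1 (fun t => \det (P t)) (\tr (\adj (P t) *m (X - 1%:M))).
  apply: is_derive_det => i j.
  apply: is_derive_ext (is_derive1_affine ((X - 1%:M) i j) ((1%:M : 'M[R]_k) i j) t) => s.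
  by rewrite !mxE; ring.
have cont : {within `[0, 1], continuous (fun t => \det (P t))}.
  by apply: derivable_within_continuous => t _; case: (hd t).
have P0 : \det (P 0) = 1 by rewrite /P subr0 scale1r scale0r addr0 det1.
have P1 : \det (P 1) = \det X by rewrite /P subrr scale0r scale1r add0r.
have Pn0 t : 0 <= t <= 1 -> \det (P t) != 0.
  move=> /andP[t0 t1]; rewrite -unitfE -unitmxE; apply: posdef_unit; case: pX => sX pX; split.
    by rewrite linearD/= !linearZ/= sX tr_scalar_mx.
  move=> v v0; rewrite quadfD !quadfZ quadf_scalar mul1r.
  have := pX v v0; have := sum_sqr_gt0 v0.
  move: (\sum_i _) (quadf _ _) => s x s0 x0.
  have [->|tn0] := eqVneq t 0; first by rewrite subr0 mul1r mul0r addr0.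
  by rewrite ltr_wpDl ?mulr_ge0 ?subr_ge0// ?ltW// mulr_gt0// lt_def tn0.
rewrite ltNge; apply/negP => dX.
have [c /[!in_itv]/= c01 c0] := @IVT _ (fun t => \det (P t)) 0 1 0 ler01 cont
  ltac:(by rewrite /= P0 P1 ge_min le_max dX ler01 orbT).
by have := Pn0 c c01; rewrite c0 eqxx.
Qed.

Lemma invmx_sym k (X : 'M[R]_k) : X^T = X -> (invmx X)^T = invmx X.
Proof. by move=> sX; rewrite trmx_inv sX. Qed.

Lemma quadf_invmx k (X : 'M[R]_k) v : posdef X ->
  quadf (invmx X) v = quadf X (v *m invmx X).
Proof.
move=> pX; rewrite /quadf trmx_mul invmx_sym ?(proj1 pX)//.
by rewrite mulmxKV ?posdef_unit// mulmxA.
Qed.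

Lemma quadf_invmx_ge0 k (X : 'M[R]_k) v : posdef X -> 0 <= quadf (invmx X) v.
Proof.
move=> pX; rewrite quadf_invmx//; have [->|v0] := eqVneq (v *m invmx X) 0.
  by rewrite /quadf !mul0mx mxE.
by rewrite ltW// (proj2 pX).
Qed.

Lemma mxtrace_invmx_gram_ge0 m k (X : 'M[R]_k) (Z : 'M[R]_(m, k)) : posdef X ->
  0 <= \tr (invmx X *m (Z^T *m Z)).
Proof.
move=> pX; rewrite mulmxA mxtrace_mulC mulmxA sumr_ge0// => a _.
by rewrite -quadf_row quadf_invmx_ge0.
Qed.

Lemma adj_invmx k (X : 'M[R]_k) : X \in unitmx -> \adj X = \det X *: invmx X.
Proof.
move=> uX; rewrite /invmx uX scalerA divff ?scale1r//.
by rewrite -unitfE -unitmxE.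
Qed.

(** Along [X + t Z^T Z] the derivative of the determinant is the determinant times the trace of
    [P(t)^-1 Z^T Z], which is nonnegative. *)
Lemma det_le_gram m k (X : 'M[R]_k) (Z : 'M[R]_(m, k)) : posdef X ->
  \det X <= \det (X + Z^T *m Z).
Proof.
move=> pX; pose P (t : R) := X + t *: (Z^T *m Z).
have pP t : 0 <= t -> posdef (P t).
  move=> t0; rewrite /P (_ : t *: _ = (Num.sqrt t *: Z)^T *m (Num.sqrt t *: Z)).
    exact: posdefD_gram.
  have -> : (Num.sqrt t *: Z)^T = Num.sqrt t *: Z^T by apply/matrixP => i j; rewrite !mxE.
  by rewrite -scalemxAl -scalemxAr scalerA -expr2 sqr_sqrtr.
have hd (t : R) : is_derive t 1 (fun t => \det (P t)) (\tr (\adj (P t) *m (Z^T *m Z))).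
  apply: is_derive_det => i j.
  apply: is_derive_ext (is_derive1_affine ((Z^T *m Z) i j) (X i j) t) => s.
  by rewrite [RHS]mxE [X in _ = _ + X]mxE addrC mulrC.
have : \det (P 0) <= \det (P 1).
  apply: (@ger0_derive1_ndecr R (fun t => \det (P t)) 0 1) => //.
  - move=> t; rewrite in_itv/= => /andP[t0 _]; rewrite derive1E; have [_ ->] := hd t.
    have pt := pP t (ltW t0); rewrite adj_invmx ?posdef_unit// -scalemxAl mxtraceZ.
    by rewrite mulr_ge0 ?mxtrace_invmx_gram_ge0// ltW// posdef_det_gt0.
  - by apply: derivable_within_continuous => t _; case: (hd t).
by rewrite /P scale0r addr0 scale1r.
Qed.

End PositiveDefinite.

(** * The regularised prior *)

Lemma mx_measurable_det (R : realType) n p k (A : 'M[R]_(n, p) -> 'M[R]_k) :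
  (forall i j, mx_measurable (fun M => A M i j)) -> mx_measurable (fun M => \det (A M)).
Proof.
move=> mA; apply: mx_measurable_sum => s; apply: mx_measurableM; first exact:
  mx_measurable_cst.
by apply: mx_measurable_prod => i; exact: mA.
Qed.

Lemma mx_measurable_gram (R : realType) n p i j :
  mx_measurable (fun M : 'M[R]_(n, p) => (M^T *m M) i j).
Proof.
apply: (mx_measurable_ext (f := fun M => \sum_a M a i * M a j)) => [M|].
  by rewrite mxE; apply: eq_bigr => a _; rewrite mxE.
by apply: mx_measurable_sum => a; apply: mx_measurableM; exact: mx_measurable_coef.
Qed.

Lemma mxdotZ (R : realType) n p (c : R) (A W : 'M[R]_(n, p)) :
  mxdot (c *: A) W = c * mxdot A W.
Proof.
rewrite /mxdot mulr_sumr; apply: eq_bigr => a _; rewrite mulr_sumr.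
by apply: eq_bigr => i _; rewrite mxE mulrA.
Qed.

Section RegularizedPrior.
Variables (R : realType) (n p : nat) (e gam : R).
Hypothesis e0 : 0 < e.
Implicit Types (M W : 'M[R]_(n, p)).

Let al : R := n%:R - p%:R - 1.

Definition reg_gram M : 'M[R]_p := e%:M + M^T *m M.
Definition reg_sqnorm M (i : 'I_p) : R := e + \sum_a M a i ^+ 2.
(** The half in [gam / 2] is due to squared column norms. With [e = 0] this also describes the
    singular prior at matrices of full rank. *)
Definition reg_log_prior M : R :=
  - (al / 2) * ln (\det (reg_gram M)) + - (gam / 2) * \sum_i ln (reg_sqnorm M i).
Definition reg_prior M : R := expR (reg_log_prior M).

Local Notation A := reg_gram.
Local Notation u := reg_sqnorm.
(** [P] is half the gradient of [ln (\det A)], and [Q] is the hat matrix of ridge regression, with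
    diagonal in [[0, 1]]. *)
Let T M := invmx (A M).
Let P M : 'M[R]_(n, p) := M *m T M.
Let Q M : 'M[R]_(n, n) := M *m T M *m M^T.

Lemma posdef_reg_gram M : posdef (A M).
Proof. by apply: posdefD_gram; exact: posdef_scalar. Qed.

Lemma reg_sqnorm_gt0 M i : 0 < u M i.
Proof. by rewrite ltr_wpDr// sumr_ge0// => a _; exact: sqr_ge0. Qed.

Lemma mx_measurable_reg_prior : mx_measurable reg_prior.
Proof.
apply: mx_measurable_comp; first exact: measurable_expR.
apply: mx_measurableD; apply: mx_measurableM; try exact: mx_measurable_cst.
  apply: mx_measurable_comp; first exact: measurable_ln.
  apply: mx_measurable_det => i j.
  apply: (mx_measurable_ext (f := fun M => (e%:M : 'M[R]_p) i j + (M^T *m M) i j)) => [M|].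
    by rewrite mxE.
  by apply: mx_measurableD; [exact: mx_measurable_cst|exact: mx_measurable_gram].
apply: mx_measurable_sum => i; apply: mx_measurable_comp; first exact: measurable_ln.
apply: mx_measurableD; first exact: mx_measurable_cst.
apply: mx_measurable_sum => a; apply: (mx_measurable_comp (h := fun x => x ^+ 2)).
  exact: measurable_funX.
exact: mx_measurable_coef.
Qed.

Let unitA M : A M \in unitmx. Proof. exact/posdef_unit/posdef_reg_gram. Qed.
Let detA M : 0 < \det (A M). Proof. exact/posdef_det_gt0/posdef_reg_gram. Qed.
Let Tsym M : (T M)^T = T M. Proof. exact/invmx_sym/(posdef_reg_gram M).1. Qed.

(** This is [T = T A T] with [A = e I + M^T M]. It writes each diagonal entry of [T] and [Q] as a
    sum of squares that contains its own square, up to the factor [e] for [T]; hence [T_diag_le] and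
    [Q_diag_le1]. *)
Lemma quadf_T M (v : 'rV[R]_p) :
  quadf (T M) v = e * \sum_i (v *m T M) 0 i ^+ 2 + \sum_a (v *m T M *m M^T) 0 a ^+ 2.
Proof.
rewrite quadf_invmx; last exact: posdef_reg_gram.
by rewrite quadfD quadf_scalar quadf_gram.
Qed.

Lemma T_diag M i : T M i i = e * \sum_j T M i j ^+ 2 + \sum_a P M a i ^+ 2.
Proof.
have := quadf_T M (delta_mx 0 i); rewrite /quadf -!rowE => h.
transitivity ((row i (T M) *m (delta_mx 0 i : 'rV[R]_p)^T) 0 0).
  by rewrite trmx_delta -colE !mxE.
rewrite h; congr (e * _ + _); apply: eq_bigr => j _; first by rewrite mxE.
by rewrite -row_mul (_ : T M *m M^T = (P M)^T) ?mxE // /P trmx_mul Tsym.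
Qed.

Lemma Q_diag M a : Q M a a = e * \sum_j P M a j ^+ 2 + \sum_b Q M a b ^+ 2.
Proof.
rewrite -quadf_row quadf_T -!row_mul; congr (e * _ + _); apply: eq_bigr => j _; by rewrite mxE.
Qed.

Lemma T_diag_ge0 M i : 0 <= T M i i.
Proof.
by rewrite T_diag addr_ge0// ?mulr_ge0 ?(ltW e0)// sumr_ge0// => j _; exact: sqr_ge0.
Qed.

Lemma P_sum_le M i : \sum_a P M a i ^+ 2 <= T M i i.
Proof.
by rewrite T_diag lerDr mulr_ge0 ?(ltW e0)// sumr_ge0// => j _; exact: sqr_ge0.
Qed.

Lemma T_diag_le M i : T M i i <= e^-1.
Proof.
have h : e * T M i i ^+ 2 <= T M i i.
  rewrite [leRHS]T_diag (bigD1 i)//= mulrDr -addrA lerDl addr_ge0//.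
    by rewrite mulr_ge0 ?(ltW e0)// sumr_ge0// => j _; exact: sqr_ge0.
  by rewrite sumr_ge0// => j _; exact: sqr_ge0.
have [->|Tn0] := eqVneq (T M i i) 0; first by rewrite invr_ge0 ltW.
have T0 : 0 < T M i i by rewrite lt_def Tn0 T_diag_ge0.
by move: h; rewrite expr2 mulrA ger_pMl// -ler_pdivlMl// mulr1.
Qed.

Lemma P_le M a i : P M a i ^+ 2 <= e^-1.
Proof.
apply: le_trans (T_diag_le M i); apply: le_trans (P_sum_le M i).
by rewrite (bigD1 a)//= lerDl sumr_ge0// => j _; exact: sqr_ge0.
Qed.

Lemma Q_diag_ge0 M a : 0 <= Q M a a.
Proof.
by rewrite Q_diag addr_ge0// ?mulr_ge0 ?(ltW e0)// sumr_ge0// => j _; exact: sqr_ge0.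
Qed.

Lemma Q_diag_le1 M a : Q M a a <= 1.
Proof.
have h : Q M a a ^+ 2 <= Q M a a.
  rewrite [leRHS]Q_diag [X in _ + X](bigD1 a)//= addrCA lerDl addr_ge0//.
    by rewrite mulr_ge0 ?(ltW e0)// sumr_ge0// => j _; exact: sqr_ge0.
  by rewrite sumr_ge0// => j _; exact: sqr_ge0.
have := Q_diag_ge0 M a; nra.
Qed.

(** A diagonal entry of this identity gives [sum_MP], its trace gives [sum_Q_le]; the term in [e]
    only lowers them. *)
Let gramT M : M^T *m P M = 1%:M - e *: T M.
Proof.
rewrite /P mulmxA (_ : M^T *m M = - e%:M + A M); last by rewrite addKr.
rewrite mulmxDl mulNmx mul_scalar_mx.
by rewrite mulmxV// addrC.
Qed.

Lemma sum_MP M i : \sum_a M a i * P M a i <= 1.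
Proof.
have -> : \sum_a M a i * P M a i = (M^T *m P M) i i.
  by rewrite [RHS]mxE; apply: eq_bigr => a _; rewrite [M^T _ _]mxE.
by rewrite gramT !mxE eqxx gerBl mulr_ge0 ?T_diag_ge0// ltW.
Qed.

Lemma sum_Q_le M : \sum_a Q M a a <= p%:R.
Proof.
have -> : \sum_a Q M a a = \tr (M^T *m P M) by rewrite -[LHS]mxtrace_mulC.
rewrite gramT linearB/= mxtraceZ mxtrace1 gerBl mulr_ge0 ?(ltW e0)// sumr_ge0// => i _.
exact: T_diag_ge0.
Qed.

Definition reg_score M : 'M[R]_(n, p) :=
  \matrix_(a, i) (- al * P M a i - gam * (M a i / u M i)).

(** Derivative of [reg_score M a i] along its own entry. The first bracket is the derivative of
    [M T]: one term from [M] and two from the derivative [- T (dA) T] of [T]. *)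
Definition reg_score_deriv M : 'M[R]_(n, p) := \matrix_(a, i)
  (- al * (T M i i - P M a i ^+ 2 - Q M a a * T M i i)
   - gam * ((u M i)^-1 - 2 * M a i ^+ 2 / u M i ^+ 2)).

Let is_derive_A M W i j :
  is_derive (0 : R) 1 (fun t => A (M + t *: W) i j) ((W^T *m M + M^T *m W) i j).
Proof.
have h1 (k : 'I_n) (l : 'I_p) : is_derive (0 : R) 1 (fun t => (M + t *: W) k l) (W k l).
  apply: is_derive_ext (is_derive1_affine (W k l) (M k l) 0) => t.
  by rewrite !mxE mulrC addrC.
have h2 (k : 'I_p) (l : 'I_n) : is_derive (0 : R) 1 (fun t => (M + t *: W)^T k l) (W^T k l).
  by rewrite mxE; apply: is_derive_ext (h1 l k) => t; rewrite [RHS]mxE.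
have := is_derive1D (is_derive1c ((e%:M : 'M[R]_p) i j) 0) (is_derive_mulmx h2 h1 i j).
rewrite scale0r addr0 add0r; apply: is_derive_ext => t.
by rewrite /reg_gram [RHS]mxE.
Qed.

Let is_derive_u M W i :
  is_derive (0 : R) 1 (fun t => u (M + t *: W) i) (2 * \sum_a M a i * W a i).
Proof.
have h a : is_derive (0 : R) 1 (fun t => (M + t *: W) a i ^+ 2) (2 * (M a i * W a i)).
  have h1 : is_derive (0 : R) 1 (fun t => (M + t *: W) a i) (W a i).
    apply: is_derive_ext (is_derive1_affine (W a i) (M a i) 0) => t.
    by rewrite !mxE mulrC addrC.
  have := is_derive1M h1 h1; rewrite scale0r addr0.
  rewrite (_ : _ + _ = 2 * (M a i * W a i)); last by ring.
  by apply: is_derive_ext => t; rewrite expr2.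
have := is_derive1D (is_derive1c e 0) (is_derive1_sum (index_enum 'I_n) h).
by rewrite add0r -mulr_sumr.
Qed.

Lemma dir_derive_reg_prior W M :
  dir_derive reg_prior W M (mxdot (reg_prior M *: reg_score M) W).
Proof.
have M0 : M + 0 *: W = M by rewrite scale0r addr0.
have dA : 0 < \det (A (M + 0 *: W)) by exact: detA.
have du i : 0 < u (M + 0 *: W) i by exact: reg_sqnorm_gt0.
have h1 := is_derive1_lnR dA (is_derive_det (is_derive_A M W)).
have h2 i := is_derive1_lnR (f := fun t => u (M + t *: W) i) (du i) (is_derive_u M W i).
have := is_derive1_expR (is_derive1D (is_derive1Mc (- (al / 2)) h1)
  (is_derive1Mc (- (gam / 2)) (is_derive1_sum (index_enum 'I_p) h2))).
congr (is_derive _ _ _ _); rewrite M0 -/(reg_prior M).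
(* The two halves of the derivative of the Gram matrix are transposes of each other and have the
   same trace against the symmetric [T M]. *)
have -> : \tr (\adj (A M) *m (W^T *m M + M^T *m W)) / \det (A M) = 2 * mxdot (P M) W.
  rewrite adj_invmx// -scalemxAl mxtraceZ mulrAC mulfV ?gt_eqF// mul1r.
  have tW : \tr (T M *m (W^T *m M)) = mxdot (P M) W.
    rewrite mxtrace_mulC -mulmxA -/(P M); rewrite /mxtrace /mxdot exchange_big/=.
    by apply: eq_bigr => i _; rewrite mxE; apply: eq_bigr => a _; rewrite mxE mulrC.
  rewrite mulmxDr linearD/= tW -[X in _ + X]mxtrace_tr !trmx_mul trmxK Tsym mxtrace_mulC tW.
  by rewrite mulr2n mulrDl mul1r.
rewrite [LHS]mulrC mxdotZ; congr (_ * _).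
transitivity (\sum_a \sum_i (- al * (P M a i * W a i)) + - (gam / 2) * \sum_i 2 * (\sum_a
  M a i * W a i) / u M i).
  congr (_ + _); rewrite /mxdot !mulr_sumr; apply: eq_bigr => a _.
  rewrite !mulr_sumr; apply: eq_bigr => i _.
  by move: (P M a i * W a i) => x; field.
rewrite mulr_sumr.
rewrite [X in _ + X = _](_ : _ = \sum_a \sum_i (- gam * (M a i * W a i / u M i))); last first.
  rewrite exchange_big/=; apply: eq_bigr => i _; rewrite -!mulr_sumr -mulr_suml.
  move: (\sum_a _) (reg_sqnorm_gt0 M i); move: (u M i) => x s x0; field.
  by rewrite gt_eqF.
rewrite -big_split/=; apply: eq_bigr => a _; rewrite -big_split/=; apply: eq_bigr => i _.
rewrite [reg_score M a i]mxE.
move: (reg_sqnorm_gt0 M i); move: (u M i) (P M a i) => x y x0; field.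
by rewrite gt_eqF.
Qed.


(** The rule [(expR f)'' = expR f * (f'' + f'^2)], for pure second derivatives only, since just the
    Laplacian is needed. *)
Definition reg_hess M : 'M[R]_(n, p) := \matrix_(a, i)
  (reg_prior M * (reg_score_deriv M a i + reg_score M a i ^+ 2)).

Let delta_mulE m k l (a b : 'I_m) (i : 'I_k) (j : 'I_l) (B : 'M[R]_(k, l)) :
  (delta_mx a i *m B) b j = (b == a)%:R * B i j.
Proof.
rewrite mxE (bigD1 i)//= mxE eqxx andbT big1 ?addr0// => r ri.
by rewrite mxE (negPf ri) andbF mul0r.
Qed.

Let mul_delta_sum m k l (C : 'M[R]_(m, k)) (a : 'I_k) (i : 'I_l) r (B : 'M[R]_(l, r)) c j :
  (C *m (delta_mx a i *m B)) c j = C c a * B i j.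
Proof.
rewrite mxE (bigD1 a)//= delta_mulE eqxx mul1r big1 ?addr0// => b ba.
by rewrite delta_mulE (negPf ba) mul0r mulr0.
Qed.

Lemma dir_derive_reg_score a i M :
  dir_derive (fun M => reg_score M a i) (delta_mx a i) M (reg_score_deriv M a i).
Proof.
pose E : 'M[R]_(n, p) := delta_mx a i.
have M0 : M + 0 *: E = M by rewrite scale0r addr0.
have h1 k l : is_derive (0 : R) 1 (fun t => (M + t *: E) k l) (E k l).
  apply: is_derive_ext (is_derive1_affine (E k l) (M k l) 0) => t.
  by rewrite !mxE mulrC addrC.
have h2 := is_derive_mulmx h1 (is_derive_invmx (fun t => unitA (M + t *: E)) (is_derive_A
  M E)) a i.
have uM0 : u (M + 0 *: E) i != 0 by rewrite gt_eqF// reg_sqnorm_gt0.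
have h3 := is_derive1M (h1 a i) (is_derive1V (f := fun t => u (M + t *: E) i) uM0
  (is_derive_u M E i)).
have := is_derive1B (is_derive1Mc (- al) h2) (is_derive1Mc gam h3).
rewrite M0 /dir_derive.
have -> : (E *m invmx (A M) + M *m - (invmx (A M) *m (E^T *m M + M^T *m E) *m invmx (A
  M))) a i =
    T M i i - P M a i ^+ 2 - Q M a a * T M i i.
  rewrite -/(T M) mulmxN mxE [X in _ + X]mxE {1}/E delta_mulE eqxx mul1r -addrA -opprD;
    congr (_ - _).
  (* The term [E^T M] yields the square of [P M a i], the term [M^T E] the product of [Q M a a] and
     [T M i i]. *)
  have -> : M *m (T M *m (E^T *m M + M^T *m E) *m T M) =
      P M *m (delta_mx i a *m P M) + Q M *m (E *m T M).
    rewrite -[delta_mx i a]trmx_delta -/E /P /Q.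
    by rewrite mulmxDr mulmxDl mulmxDr !mulmxA.
  by rewrite mxE !mul_delta_sum expr2.
have -> : \sum_a0 M a0 i * E a0 i = M a i.
  rewrite (bigD1 a)//= mxE !eqxx mulr1 big1 ?addr0// => b ba.
  by rewrite mxE (negPf ba) mulr0.
have -> : E a i = 1 by rewrite mxE !eqxx.
have -> : - al * (T M i i - P M a i ^+ 2 - Q M a a * T M i i) -
    gam * (1 * (u M i)^-1 + M a i * (- (2 * M a i) / u M i ^+ 2)) = reg_score_deriv M a i.
  by rewrite [RHS]mxE mul1r; congr (_ - _ * (_ + _)); rewrite mulNr mulrN mulrA mulrCA
    -expr2 mulrA.
by apply: is_derive_ext => t; rewrite [RHS]mxE.
Qed.

Lemma dir_derive_reg_grad a i M :
  dir_derive (fun M => (reg_prior M *: reg_score M) a i) (delta_mx a i) M (reg_hess M a i).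
Proof.
have h1 := dir_derive_reg_prior (delta_mx a i) M.
have := is_derive1M h1 (dir_derive_reg_score a i M).
rewrite scale0r addr0 mxdot_delta.
rewrite (_ : _ + _ = reg_hess M a i); last first.
  by rewrite [RHS]mxE [X in X * _ + _]mxE mulrDr expr2 mulrA addrC.
by apply: is_derive_ext => t; rewrite [RHS]mxE.
Qed.

Hypothesis gam0 : 0 < gam.
Hypothesis pn : (p < n)%N.
Hypothesis gam_le : gam <= - n%:R + 2 * p%:R.

Let al0 : 0 <= al.
Proof. by rewrite /al -addrA -opprD subr_ge0 natr1 ler_nat. Qed.

(** After the sums over the column are bounded, two coefficients remain. That of [T M i i] is
    [al * (al + 1 + p - n)], which is 0 by the value of [al]. That of [gam / u M i] is
    [2 * al + 2 + gam - n = gam + n - 2 * p], where [2 * al] comes from the cross term of the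
    squared score; here the bound on [gam] enters. *)
Lemma sum_reg_score_le M i :
  \sum_a (reg_score_deriv M a i + reg_score M a i ^+ 2) <= 0.
Proof.
have u0 := reg_sqnorm_gt0 M i.
pose v := (u M i)^-1; have v0 : 0 < v by rewrite invr_gt0.
have -> : \sum_a (reg_score_deriv M a i + reg_score M a i ^+ 2) =
    - al * T M i i * n%:R + (al + al ^+ 2) * (\sum_a P M a i ^+ 2)
    + al * T M i i * (\sum_a Q M a a) - gam * v * n%:R
    + (2 * gam + gam ^+ 2) * v ^+ 2 * (\sum_a M a i ^+ 2)
    + 2 * al * gam * v * (\sum_a M a i * P M a i).
  have -> : (n%:R : R) = \sum_(a < n) 1 by rewrite sumr_const card_ord.
  rewrite !mulr_sumr -sumrN -!big_split/=; apply: eq_bigr => a _.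
  rewrite [reg_score_deriv M a i]mxE [reg_score M a i]mxE -exprVn -/v.
  move: (P M a i) (Q M a a) (T M i i) (M a i) => x1 x2 x3 x4; ring.
have T0 := T_diag_ge0 M i.
have c0 : 0 <= al + al ^+ 2 by rewrite addr_ge0// sqr_ge0.
have h1 : (al + al ^+ 2) * (\sum_a P M a i ^+ 2) <= (al + al ^+ 2) * T M i i.
  by rewrite ler_wpM2l// P_sum_le.
have h2 : al * T M i i * (\sum_a Q M a a) <= al * T M i i * p%:R.
  by rewrite ler_wpM2l ?mulr_ge0// sum_Q_le.
have h3 : (2 * gam + gam ^+ 2) * v ^+ 2 * (\sum_a M a i ^+ 2) <= (2 * gam + gam ^+ 2) * v.
  have k0 : 0 <= 2 * gam + gam ^+ 2 by rewrite addr_ge0 ?sqr_ge0// mulr_ge0// ltW.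
  rewrite -mulrA ler_wpM2l// expr2 -mulrA ler_piMr ?(ltW v0)//.
  by rewrite /v mulrC ler_pdivrMr// mul1r lerDr ltW.
have h4 : 2 * al * gam * v * (\sum_a M a i * P M a i) <= 2 * al * gam * v.
  by rewrite ler_piMr ?sum_MP// !mulr_ge0 ?(ltW gam0) ?(ltW v0).
have h5 : gam * v * (2 * al + 2 + gam - n%:R) <= 0.
  apply: mulr_ge0_le0; first by rewrite mulr_ge0 ?(ltW gam0) ?(ltW v0).
  by rewrite /al; move: gam_le; lra.
have h6 : T M i i * (al * (al + 1 + p%:R - n%:R)) = 0.
  rewrite (_ : al + 1 + p%:R - n%:R = 0) ?mulr0// /al; ring.
move: h1 h2 h3 h4 h5 h6.
move: (\sum_a P M a i ^+ 2) (\sum_a Q M a a) (\sum_a M a i ^+ 2) (\sum_a M a i * P M a i)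
  (T M i i) => s1 s2 s3 s4 t.
move: (al : R) => al'; lra.
Qed.

Lemma reg_laplacian_le0 M : \sum_a \sum_i reg_hess M a i <= 0.
Proof.
rewrite exchange_big/= sumr_le0// => i _.
under eq_bigr do rewrite mxE.
by rewrite -mulr_sumr mulr_ge0_le0 ?sum_reg_score_le// expR_ge0.
Qed.

(** A number whose square is at most [e^-1] is at most [1 + e^-1] in absolute value, which avoids
    square roots. *)
Definition reg_grad_bound : R := (al + gam) * (1 + e^-1).
(** Both brackets of [reg_score_deriv] have three terms of size at most [e^-1], the doubled one
    counted twice. *)
Definition reg_hess_bound : R := 3 * (al + gam) * e^-1.

Lemma reg_score_le M a i : `|reg_score M a i| <= reg_grad_bound.
Proof.
have sq_le (x : R) : x ^+ 2 <= e^-1 -> `|x| <= 1 + e^-1.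
  by rewrite -[x ^+ 2]real_normK ?num_real// => h; have := normr_ge0 x; nra.
have hP := sq_le _ (P_le M a i).
have hM : `|M a i / u M i| <= 1 + e^-1.
  apply: sq_le; have u0 := reg_sqnorm_gt0 M i.
  have ue : (u M i)^-1 <= e^-1.
    by rewrite lef_pV2 ?posrE// lerDl sumr_ge0// => b _; exact: sqr_ge0.
  apply: le_trans ue; rewrite expr_div_n expr2 ler_pdivrMr ?exprn_gt0//.
  rewrite expr2 mulrA mulVf ?gt_eqF// mul1r /reg_sqnorm (bigD1 a)//= addrCA -expr2 lerDl.
  by rewrite addr_ge0 ?(ltW e0)// sumr_ge0// => b _; exact: sqr_ge0.
rewrite [reg_score M a i]mxE (le_trans (ler_normB _ _))// (normrM (- al)) (normrM gam) normrN.
by rewrite (ger0_norm al0) (gtr0_norm gam0) /reg_grad_bound [leRHS]mulrDl lerD//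
  ler_wpM2l// ltW.
Qed.

Lemma reg_score_deriv_le M a i : `|reg_score_deriv M a i| <= reg_hess_bound.
Proof.
have T0 := T_diag_ge0 M i; have T1 := T_diag_le M i; have P1 := P_le M a i.
have Q0 := Q_diag_ge0 M a; have Q1 := Q_diag_le1 M a; have u0 := reg_sqnorm_gt0 M i.
have ei : 0 < e^-1 by rewrite invr_gt0.
have P0 := sqr_ge0 (P M a i).
have ue : (u M i)^-1 <= e^-1.
  by rewrite lef_pV2 ?posrE// lerDl sumr_ge0// => b _; exact: sqr_ge0.
have M1 : M a i ^+ 2 / u M i ^+ 2 <= e^-1.
  apply: le_trans ue; rewrite ler_pdivrMr ?exprn_gt0//.
  rewrite expr2 mulrA mulVf ?gt_eqF// mul1r /reg_sqnorm (bigD1 a)//= addrCA -expr2 lerDl.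
  by rewrite addr_ge0 ?(ltW e0)// sumr_ge0// => b _; exact: sqr_ge0.
have M0 : 0 <= M a i ^+ 2 / u M i ^+ 2 by rewrite divr_ge0 ?sqr_ge0.
have ui : 0 < (u M i)^-1 by rewrite invr_gt0.
have QT1 : Q M a a * T M i i <= e^-1 by rewrite -[e^-1]mul1r ler_pM.
have QT0 : 0 <= Q M a a * T M i i by rewrite mulr_ge0.
rewrite [reg_score_deriv M a i]mxE (le_trans (ler_normB _ _))// (normrM (- al)) (normrM
  gam) normrN.
rewrite (ger0_norm al0) (gtr0_norm gam0).
have -> : reg_hess_bound = al * (3 * e^-1) + gam * (3 * e^-1) by rewrite /reg_hess_bound; ring.
rewrite lerD//.
  by rewrite ler_wpM2l// ler_norml; lra.
by rewrite ler_wpM2l ?(ltW gam0)// -mulrA ler_norml; lra.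
Qed.

(** The value of [reg_prior] at the zero matrix, where it is largest. *)
Definition reg_bound : R :=
  expR (- (al / 2) * ln (\det (e%:M : 'M[R]_p)) + - (gam / 2) * \sum_(i < p) ln e).

Lemma reg_prior_le M : reg_prior M <= reg_bound.
Proof.
have h : \det (e%:M : 'M[R]_p) <= \det (A M) by apply: det_le_gram; exact: posdef_scalar.
have d0 : 0 < \det (e%:M : 'M[R]_p) by apply: posdef_det_gt0; exact: posdef_scalar.
rewrite ler_expR lerD//.
  by rewrite !mulNr lerN2 ler_wpM2l ?divr_ge0// ler_ln ?posrE.
rewrite !mulNr lerN2 ler_wpM2l ?divr_ge0 ?(ltW gam0)// ler_sum// => i _.
by rewrite ler_ln ?posrE ?reg_sqnorm_gt0// lerDl sumr_ge0// => a _; exact: sqr_ge0.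
Qed.

Lemma superharmonic_reg_prior : superharmonic reg_prior
  (fun M => reg_prior M *: reg_score M) reg_hess reg_bound
  (reg_grad_bound + (reg_hess_bound + reg_grad_bound ^+ 2)).
Proof.
have g0 : 0 <= reg_grad_bound.
  by apply: mulr_ge0; apply: addr_ge0; rewrite ?invr_ge0 ?(ltW gam0) ?(ltW e0).
have h0 : 0 <= reg_hess_bound.
  by rewrite mulr_ge0 ?invr_ge0 ?(ltW e0)// mulr_ge0// addr_ge0// ltW.
have C0 : 0 <= reg_hess_bound + reg_grad_bound ^+ 2 by rewrite addr_ge0 ?sqr_ge0.
split.
- exact: mx_measurable_reg_prior.
- by move=> M; exact: expR_gt0.
- exact: reg_prior_le.
- by rewrite addr_ge0.
- exact: dir_derive_reg_prior.
- exact: dir_derive_reg_grad.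
- move=> a i M; rewrite mxE normrM ger0_norm ?expR_ge0// mulrC ler_wpM2r ?expR_ge0//.
  by rewrite (le_trans (reg_score_le M a i))// lerDl.
- move=> a i M; rewrite mxE normrM ger0_norm ?expR_ge0// mulrC ler_wpM2r ?expR_ge0//.
  rewrite (le_trans (ler_normD _ _))// ler_wpDl// lerD ?reg_score_deriv_le//.
  by rewrite normrX lerXn2r ?nnegrE ?reg_score_le.
- exact: reg_laplacian_le0.
Qed.

End RegularizedPrior.

(** * The singular prior as a limit *)

Section SingularPrior.
Variables (R : realType) (n p : nat) (gam : R).
Hypothesis gam0 : 0 < gam.
Hypothesis pn : (p + 1 < n)%N.
Implicit Types M : 'M[R]_(n, p).

Local Notation prior := (@pi_MSVS2 R n p gam).
Local Notation reg e := (@reg_prior R n p e gam).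
Let al : R := n%:R - p%:R - 1.
Let al_gt0 : 0 < al.
Proof. by rewrite /al -addrA -opprD subr_gt0 natr1 -addn1 ltr_nat. Qed.

Lemma pi_MSVS2_ge0 M : 0 <= prior M.
Proof. by rewrite mulr_ge0 ?powR_ge0// prodr_ge0// => i _; exact: powR_ge0. Qed.

Lemma mx_measurable_pi_MSVS2 : mx_measurable prior.
Proof.
apply: mx_measurableM.
  apply: (mx_measurable_comp (h := fun x => x `^ (- (al / 2)))); first exact: measurable_powR.
  by apply: mx_measurable_det => i j; exact: mx_measurable_gram.
apply: mx_measurable_prod => i.
apply: (mx_measurable_comp (h := fun x => x `^ (- gam))); first exact: measurable_powR.
apply: (mx_measurable_comp (h := Num.sqrt)); first exact: (continuous_measurable_fun
  (@sqrt_continuous R)).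
apply: mx_measurable_sum => a; apply: (mx_measurable_comp (h := fun x => x ^+ 2)).
  exact: measurable_funX.
exact: mx_measurable_coef.
Qed.

Lemma posdef_gram M : \det (M^T *m M) != 0 -> posdef (M^T *m M).
Proof.
move=> d0; split=> [|v v0]; first by rewrite trmx_mul trmxK.
rewrite quadf_gram lt_def sumr_ge0 ?andbT => [|a _]; last exact: sqr_ge0.
apply: contra v0 => /eqP /psumr_eq0P h.
have vM : v *m M^T = 0.
  apply/rowP => a; rewrite [RHS]mxE; apply/eqP; rewrite -sqrf_eq0 h// => b _; exact: sqr_ge0.
have uS : M^T *m M \in unitmx by rewrite unitmxE unitfE.
by rewrite -[v](mulmxK uS) mulmxA vM !mul0mx.
Qed.

Lemma sqnorm_gt0 M i : \det (M^T *m M) != 0 -> 0 < \sum_a M a i ^+ 2.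
Proof.
move=> /posdef_gram [_ /(_ (delta_mx 0 i))]; rewrite quadf_gram.
have -> : \sum_a ((delta_mx 0 i : 'rV[R]_p) *m M^T) 0 a ^+ 2 = \sum_a M a i ^+ 2.
  by apply: eq_bigr => a _; rewrite -rowE !mxE.
apply; apply/eqP => /matrixP /(_ 0 i) /eqP; rewrite !mxE !eqxx.
by rewrite oner_eq0.
Qed.

Lemma reg_gram0 M : reg_gram 0 M = M^T *m M.
Proof. by rewrite /reg_gram raddf0 add0r. Qed.

(** Full rank matters: where the determinant vanishes, [powR] makes the prior 0, while the
    regularised priors blow up. *)
Lemma pi_MSVS2E M : \det (M^T *m M) != 0 -> prior M = reg 0 M.
Proof.
move=> d0; rewrite /reg_prior /reg_log_prior expRD; congr (_ * _).
  by rewrite /powR (negPf d0) reg_gram0.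
rewrite -mulNr mulr_sumr expR_sum; apply: eq_bigr => i _.
have s0 := sqnorm_gt0 i d0.
rewrite /powR gt_eqF ?sqrtr_gt0//; congr expR; rewrite /reg_sqnorm add0r.
have -> : \sum_a M a i ^+ 2 = colnorm M i ^+ 2 by rewrite sqr_sqrtr// ltW.
by rewrite lnXn ?sqrtr_gt0// -mulr_natl; field.
Qed.

(** Adding [e%:M], itself a Gram matrix, raises the determinant, and the exponents are negative. The
    singular prior thus dominates its own approximations. *)
Lemma reg_prior_le_pi M e : 0 < e -> \det (M^T *m M) != 0 -> reg e M <= prior M.
Proof.
move=> e0 d0; rewrite pi_MSVS2E// ler_expR.
have pS := posdef_gram d0; have dS := posdef_det_gt0 pS.
apply: lerD.
  rewrite !mulNr lerN2 ler_wpM2l ?divr_ge0 ?(ltW al_gt0)// ler_ln ?posrE//.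
  - rewrite reg_gram0 /reg_gram addrC.
    rewrite (_ : e%:M = (Num.sqrt e)%:M^T *m (Num.sqrt e)%:M); first exact: det_le_gram.
    by rewrite tr_scalar_mx -scalar_mxM -expr2 sqr_sqrtr// ltW.
  - by rewrite reg_gram0.
  - exact/posdef_det_gt0/posdef_reg_gram.
rewrite !mulNr lerN2 ler_wpM2l ?divr_ge0 ?(ltW gam0)// ler_sum// => i _.
have s0 := sqnorm_gt0 i d0.
by rewrite /reg_sqnorm add0r ler_ln ?posrE ?addr_gt0// lerDr ltW.
Qed.

Let det_reg_cvg M : \det (reg_gram e M) @[e --> (0:R)] --> \det (M^T *m M).
Proof.
have h : is_derive (0:R) 1 (fun e => \det (reg_gram e M)) (\tr (\adj (reg_gram 0 M) *m 1%:M)).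
  apply: is_derive_det => i j.
  apply: is_derive_ext (is_derive1_affine ((1%:M : 'M[R]_p) i j) ((M^T *m M) i j) 0) => t.
  by rewrite !mxE mulr_natl.
have : {for (0:R), continuous (fun e => \det (reg_gram e M))}.
  by apply/differentiable_continuous/derivable1_diffP; case: h.
by rewrite -reg_gram0.
Qed.

Let eps (j : nat) : R := j.+1%:R^-1.
Let eps_gt0 j : 0 < eps j. Proof. by rewrite invr_gt0. Qed.
Let eps_cvg : eps @ \oo --> (0 : R). Proof. exact: cvg_harmonic. Qed.

Lemma reg_prior_cvg M : \det (M^T *m M) != 0 -> reg (eps j) M @[j --> \oo] --> prior M.
Proof.
move=> d0; rewrite pi_MSVS2E//.
have dS := posdef_det_gt0 (posdef_gram d0).
have c0 : {for (0:R), continuous (fun e => reg e M)}.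
  apply/differentiable_continuous/derivable1_diffP.
  have h1 : is_derive (0:R) 1 (fun e => \det (reg_gram e M)) (\tr (\adj (reg_gram 0 M) *m
    1%:M)).
    apply: is_derive_det => i j.
    apply: is_derive_ext (is_derive1_affine ((1%:M : 'M[R]_p) i j) ((M^T *m M) i j) 0) => t.
    by rewrite !mxE mulr_natl.
  have h2 i : is_derive (0:R) 1 (fun e => reg_sqnorm e M i) 1.
    by apply: is_derive_ext (is_derive1_affine 1 (\sum_a M a i ^+ 2) 0) => t; rewrite mul1r.
  have dS' : 0 < \det (reg_gram 0 M) by rewrite reg_gram0.
  have s0 i : 0 < reg_sqnorm 0 M i by rewrite /reg_sqnorm add0r sqnorm_gt0.
  have := is_derive1_expR (is_derive1D (is_derive1Mc (- (al / 2)) (is_derive1_lnR dS' h1))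
    (is_derive1Mc (- (gam / 2)) (is_derive1_sum (index_enum 'I_p) (fun i =>
      is_derive1_lnR (f := fun e => reg_sqnorm e M i) (s0 i) (h2 i))))).
  by case.
exact: (cvg_comp _ _ eps_cvg c0).
Qed.

Lemma reg_prior_cvgy M : \det (M^T *m M) = 0 ->
  (reg (eps j) M)%:E @[j --> \oo] --> +oo%E.
Proof.
move=> d0; apply/cvgeryP/cvgryPge => K.
(* As [eps j <= 1], the column factors are at least their value [expR c] at [e = 1]; [delta] is the
   determinant at which [- (al / 2) * ln delta = K - c]. *)
pose c : R := - (gam / 2) * \sum_i ln (reg_sqnorm 1 M i).
pose delta : R := expR (- (2 / al) * (K - c)).
have : \det (reg_gram (eps j) M) @[j --> \oo] --> (0 : R).
  by rewrite -d0; exact: (cvg_comp _ _ eps_cvg (@det_reg_cvg M)).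
move=> /cvgr_lt /(_ delta (expR_gt0 _)); apply: filterS => j dj.
have e0 := eps_gt0 j.
have dg : 0 < \det (reg_gram (eps j) M) by exact/posdef_det_gt0/posdef_reg_gram.
have h1 : ln (\det (reg_gram (eps j) M)) <= - (2 / al) * (K - c).
  by rewrite -[leRHS]expRK ler_ln ?posrE ?expR_gt0// ltW.
have h2 : c <= - (gam / 2) * \sum_i ln (reg_sqnorm (eps j) M i).
  rewrite /c !mulNr lerN2 ler_wpM2l ?divr_ge0 ?(ltW gam0)// ler_sum// => i _.
  by rewrite ler_ln ?posrE ?reg_sqnorm_gt0// lerD2r invf_le1// ler1n.
apply: le_trans (expR_ge1Dx _) => //.
have h3 : K - c <= - (al / 2) * ln (\det (reg_gram (eps j) M)).
  rewrite -(ler_pM2l (_ : 0 < 2 / al)) ?divr_gt0//.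
  rewrite (_ : 2 / al * (- (al / 2) * _) = - ln (\det (reg_gram (eps j) M))).
    by rewrite lerNr -mulNr.
  by move: (ln _) al_gt0 => l; move: (al : R) => a a0; field; rewrite gt_eqF.
rewrite /reg_log_prior -/al; move: h3 h2; lra.
Qed.

Definition base_point : 'M[R]_(n, p) := \matrix_(a, i) (a == i :> nat)%:R.

(** With [M^T M = I] all the logarithms are nonnegative, whatever [e]. This uniformity is what the
    limit in [e] rests on. *)
Lemma reg_prior_base e : 0 < e -> reg e base_point <= 1.
Proof.
move=> e0.
have S1 : base_point^T *m base_point = 1%:M.
  apply/matrixP => i j; rewrite !mxE.
  have lt_in : (i < n)%N by rewrite (ltn_trans (ltn_ord i))// (leq_ltn_trans _ pn)// leq_addr.
  rewrite (bigD1 (Ordinal lt_in))//= !mxE eqxx mul1r big1 ?addr0// => a ai.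
  rewrite !mxE (_ : (a == i :> nat) = false) ?mul0r//.
  by apply/negbTE; apply: contra ai => /eqP ai; apply/eqP/val_inj.
rewrite -expR0 ler_expR -[leRHS]addr0 lerD//.
  rewrite mulNr oppr_le0 mulr_ge0 ?divr_ge0 ?(ltW al_gt0)// ln_ge0//.
  rewrite /reg_gram S1 -raddfD/= det_scalar exprn_ege1// lerDr ltW//.
rewrite mulNr oppr_le0 mulr_ge0 ?divr_ge0 ?(ltW gam0)// sumr_ge0// => i _.
have -> : reg_sqnorm e base_point i = e + (base_point^T *m base_point) i i.
  by rewrite mxE; congr (_ + _); apply: eq_bigr => a _; rewrite [X in _ = X * _]mxE expr2.
by rewrite S1 mxE eqxx ln_ge0// lerDr ltW.
Qed.

End SingularPrior.

(** * Passage to the limit *)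

Lemma fatou_cvg_le d (T : measurableType d) (R : realType) (mu : {measure set T -> \bar R})
    (f : nat -> T -> \bar R) (g : T -> \bar R) (c : \bar R) :
  (forall j, measurable_fun setT (f j)) -> (forall j x, 0 <= f j x)%E ->
  (forall x, f^~ x @ \oo --> g x) -> (forall j, \int[mu]_x f j x <= c)%E ->
  (\int[mu]_x g x <= c)%E.
Proof.
move=> mf f0 fg fc.
have -> : (\int[mu]_x g x = \int[mu]_x limn_einf (f^~ x))%E.
  apply: eq_integral => x _; rewrite is_cvg_limn_einfE; last by apply/cvg_ex; exists (g x).
  by apply/esym/cvg_lim => //; exact: fg.
have h := @fatou _ _ _ mu setT measurableT f mf (fun j x _ => f0 j x).
apply: (le_trans h).
rewrite limn_einf_lim; apply: lime_le; first exact: is_cvg_einfs.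
apply: nearW => j; apply: le_trans (fc j); apply: ereal_inf_lbound.
by exists j => //=.
Qed.

(** * Comparison of Gaussians with different centres *)

Section GaussianComparison.
Variables (R : realType) (n p : nat).
Implicit Types (M Y : 'M[R]_(n, p)).

Lemma frob2D_le M Y : frob2 (M + Y) <= 2 * frob2 M + 2 * frob2 Y.
Proof.
rewrite /frob2 !mulr_sumr -big_split ler_sum// => a _ /=.
rewrite !mulr_sumr -big_split ler_sum// => i _ /=.
by rewrite mxE; have := sqr_ge0 (M a i - Y a i); move: (M a i) (Y a i) => x y; lra.
Qed.

(** The precision is halved twice: once to absorb the linear factor, once to move the centre by
    [|M - Y0|^2 <= 2 |M - Y|^2 + 2 |Y - Y0|^2]. *)
Lemma lik_compare (N : R) Y Y0 a i : 0 < N -> exists2 K, 0 < K & forall M,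
  (1 + `|M a i|) * lik N Y M <= K * lik (N / 4) Y0 M.
Proof.
move=> N0.
have N4 : 0 < N / 4 by rewrite divr_gt0.
have N2 : 0 < N / 2 by rewrite divr_gt0.
pose E := expR (1 ^+ 2 / (2 * (N / 2))).
pose W := expR (N / 4 * frob2 (Y - Y0)).
pose K := (1 + `|Y a i|) * E * W * (lik_peak n p N / lik_peak n p (N / 4)).
have peak0 := lik_peak_gt0 n p N0; have peak4 := lik_peak_gt0 n p N4.
exists K.
  by rewrite !mulr_gt0 ?invr_gt0 ?expR_gt0// ltr_wpDr.
move=> M; rewrite !lik_gauss.
have h1 : (1 + `|M a i|) <= (1 + `|Y a i|) * expR (1 * `|(M - Y) a i|).
  have h : `|M a i| <= `|Y a i| + `|(M - Y) a i|.
    rewrite (_ : M a i = Y a i + (M - Y) a i) ?ler_normD//.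
    by rewrite !mxE; ring.
  have := expR_ge1Dx `|(M - Y) a i|; rewrite mul1r.
  have := normr_ge0 ((M - Y) a i); have := normr_ge0 (Y a i).
  move: h; move: `|M a i| `|Y a i| `|(M - Y) a i| (expR _) => x y z w; nra.
have h2 : expR (1 * `|(M - Y) a i|) * gauss (N / 2) (M - Y) <= E * gauss (N / 2 / 2) (M - Y).
  exact: gauss_absorb.
have h3 : gauss (N / 2 / 2) (M - Y) <= W * gauss (N / 4 / 2) (M - Y0).
  rewrite -expRD ler_expR.
  have := frob2D_le (M - Y) (Y - Y0); rewrite addrA subrK.
  move: (frob2 (M - Y)) (frob2 (Y - Y0)) (frob2 (M - Y0)) => x y z h.
  have : N * z <= N * (2 * x + 2 * y) by rewrite ler_pM2l.
  lra.
rewrite mulrCA.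
have -> : K * (lik_peak n p (N / 4) * gauss (N / 4 / 2) (M - Y0)) =
    lik_peak n p N * ((1 + `|Y a i|) * (E * (W * gauss (N / 4 / 2) (M - Y0)))).
  rewrite /K; move: (lik_peak _ _ N) (lik_peak _ _ _) peak4 (gauss _ _) => x y y0 z.
  by field; rewrite gt_eqF.
rewrite ler_pM2l//; apply: le_trans (ler_wpM2r (expR_ge0 _) h1) _.
rewrite -[leLHS]mulrA ler_wpM2l ?addr_ge0//; apply: le_trans h2 _.
by rewrite ler_wpM2l ?expR_ge0.
Qed.

End GaussianComparison.

Section SingularLimit.
Context (R : realType) (n p : nat) d (T : measurableType d).
Variables (mu : {sigma_finite_measure set T -> \bar R}) (ev : T -> 'M[R]_(n, p)).
Hypothesis mev : forall a i, measurable_fun setT (fun v => ev v a i).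
Hypothesis matintE : forall f, mx_measurable f -> (forall M, (0 <= f M)%E) ->
  matint f = (\int[mu]_v f (ev v))%E.
Variables N gam : R.
Hypothesis N0 : 0 < N.
Hypothesis gam0 : 0 < gam.
Hypothesis pn : (p + 1 < n)%N.
Hypothesis gam_le : gam <= - n%:R + 2 * p%:R.
Implicit Types (M Y X : 'M[R]_(n, p)).

Local Notation mxint := (mx_Rintegral mu ev).
Local Notation mxintegrable := (mx_integrable mu ev).
Local Notation prior := (@pi_MSVS2 R n p gam).
Local Notation Y0 := (base_point R n p).

Let eps (j : nat) : R := j.+1%:R^-1.
Let eps_gt0 j : 0 < eps j. Proof. by rewrite invr_gt0. Qed.
Let q j : 'M[R]_(n, p) -> R := reg_prior (eps j) gam.
Let pn' : (p < n)%N. Proof. by rewrite (leq_ltn_trans _ pn)// leq_addr. Qed.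
Let sh j := superharmonic_reg_prior (eps_gt0 j) gam0 pn' gam_le.
Let mprior : mx_measurable prior := @mx_measurable_pi_MSVS2 R n p gam.
Let q_gt0 j M : 0 < q j M. Proof. exact: expR_gt0. Qed.
Let mq j : mx_measurable (q j). Proof. exact: mx_measurable_reg_prior. Qed.

Let fullrank M := \det (M^T *m M) != 0.

Let cvg_scaled_reg (c : R) M : fullrank M ->
  c * q j M @[j --> \oo] --> c * prior M.
Proof.
by move=> fr; apply: cvgM; [exact: cvg_cst|exact: (reg_prior_cvg fr)].
Qed.

(** The true pointwise limit of the regularised integrands, unlike [prior], which is 0 at
    rank-deficient matrices. Its infinite value there is what makes that set negligible. *)
Let wprior N' M : \bar R :=
  if fullrank M then (lik N' Y0 M * prior M)%:E else +oo%E.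

(** Fatou and the mean value inequality at [Y0]. The precision is free because domination uses
    [N / 4]. *)
Lemma integral_wprior_le (N' : R) : 0 < N' ->
  measurable_fun setT (fun v => wprior N' (ev v)) /\
  (\int[mu]_v wprior N' (ev v) <= 1)%E.
Proof.
move=> N'0; pose f j v := (lik N' Y0 (ev v) * q j (ev v))%:E.
have mf j : measurable_fun setT (f j).
  apply: (measurable_mxint_fun mev (f := fun M => lik N' Y0 M * q j M)).
  by apply: mx_measurableM; [exact: mx_measurable_lik|exact: mq].
have fg v : f^~ v @ \oo --> wprior N' (ev v).
  rewrite /wprior; case: ifPn => [fr|/negPn/eqP d0].
    by apply: cvg_EFin; [exact: nearW|exact: cvg_scaled_reg].
  have /cvgeryP/cvgryPge h := reg_prior_cvgy gam0 pn d0.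
  have l0 := lik_gt0 Y0 (ev v) N'0.
  apply/cvgeryP/cvgryPge => K; have := h (K / lik N' Y0 (ev v)).
  by apply: filterS => j; rewrite ler_pdivrMr// mulrC.
split; first by apply: emeasurable_fun_cvg mf _ => v _; exact: fg.
apply: fatou_cvg_le mf _ fg _ => [j v|j].
  by rewrite lee_fin mulr_ge0// ltW// ?lik_gt0.
have [ij Ej] := (mxintegrable_lik_prior mev matintE N'0 (sh j) Y0,
  mxint_lik_prior matintE N' (sh j) Y0).
have fin : (\int[mu]_v f j v)%E \is a fin_num by exact: (integrable_fin_num measurableT ij).
rewrite -(fineK fin) lee_fin.
rewrite [X in X <= _](_ : _ = gauss_conv mu ev N' 1 (q j) Y0); last exact: Ej.
apply: le_trans (conv1_le mev matintE N'0 (sh j) Y0) _.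
exact: (reg_prior_base gam0 pn (eps_gt0 j)).
Qed.

Lemma ae_fullrank : {ae mu, forall v, fullrank (ev v)}.
Proof.
have [mw w1] := integral_wprior_le N0.
have w0 M : (0 <= wprior N M)%E.
  rewrite /wprior; case: ifP => // _; rewrite lee_fin mulr_ge0 ?pi_MSVS2_ge0//.
  by rewrite ltW// lik_gt0.
have iw : mu.-integrable setT (fun v => wprior N (ev v)).
  apply/integrableP; split => //; under eq_integral do rewrite gee0_abs//.
  exact: le_lt_trans w1 (ltry _).
apply: filterS (integrable_ae measurableT iw) => v /(_ I).
by rewrite /wprior; case: ifP.
Qed.

Lemma mxintegrable_base (N' : R) : 0 < N' -> mxintegrable (fun M => lik N' Y0 M * prior M).
Proof.
move=> N'0; have [mw w1] := integral_wprior_le N'0.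
have mf : mx_measurable (fun M => lik N' Y0 M * prior M).
  by apply: mx_measurableM; [exact: mx_measurable_lik|exact: mprior].
apply/integrableP; split; first exact: (measurable_mxint_fun mev mf).
have f0 M : 0 <= lik N' Y0 M * prior M.
  by rewrite mulr_ge0 ?pi_MSVS2_ge0// ltW// lik_gt0.
apply: le_lt_trans (ltry 1); apply: le_trans w1; apply: ge0_le_integral => //.
- exact: (measurableT_comp (@abse_measurable _ setT) (measurable_mxint_fun mev mf)).
- move=> v _; rewrite gee0_abs ?lee_fin// /wprior; case: ifP => // _.
  by rewrite leey.
Qed.

Section Dominated.
Variables (Y : 'M[R]_(n, p)) (a : 'I_n) (i : 'I_p) (w : 'M[R]_(n, p) -> R).
Hypothesis mw : mx_measurable w.
Hypothesis w_le : forall M, `|w M| <= 1 + `|M a i|.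

(** The weight [w] is 1 for the marginal and an entry of [M] for the numerator of the posterior
    mean. The dominating function is centred at [Y0], where integrability is known. *)
Lemma mxint_reg_cvg : mxintegrable (fun M => w M * lik N Y M * prior M) /\
  mxint (fun M => w M * lik N Y M * q j M) @[j --> \oo] -->
  mxint (fun M => w M * lik N Y M * prior M).
Proof.
have [K K0 HK] := lik_compare Y Y0 a i N0.
have N4 : 0 < N / 4 by rewrite divr_gt0.
have mwl : mx_measurable (fun M => w M * lik N Y M).
  by apply: mx_measurableM => //; exact: mx_measurable_lik.
pose g M := K * (lik (N / 4) Y0 M * prior M).
have ig : mxintegrable g by apply: mxintegrableZ; exact: mxintegrable_base.
have bound M x : 0 <= x -> x <= prior M -> `|w M * lik N Y M * x| <= g M.
  move=> x0 xp; rewrite normrM (ger0_norm x0) /g mulrA ler_pM//.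
  rewrite normrM (gtr0_norm (lik_gt0 _ _ N0)); apply: le_trans (HK M).
  by rewrite ler_wpM2r// ltW// lik_gt0.
have mqj j := measurable_mxint_fun mev (mx_measurableM mwl (mq j)).
have mp := measurable_mxint_fun mev (mx_measurableM mwl mprior).
have fcv : {ae mu, forall v, setT v ->
    (fun j => (w (ev v) * lik N Y (ev v) * q j (ev v))%:E) @ \oo -->
    (w (ev v) * lik N Y (ev v) * prior (ev v))%:E}.
  apply: filterS ae_fullrank => v fr _; apply: cvg_EFin; first exact: nearW.
  exact: cvg_scaled_reg.
have fbd : {ae mu, forall v j, setT v ->
    (`|(w (ev v) * lik N Y (ev v) * q j (ev v))%:E| <= (g (ev v))%:E)%E}.
  apply: filterS ae_fullrank => v fr j _; rewrite lee_fin; apply: bound.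
    by rewrite ltW.
  exact: (reg_prior_le_pi gam0 pn (eps_gt0 j) fr).
have [ip _ cv] := dominated_convergence measurableT mqj mp fcv ig fbd.
by split=> //; apply: fine_cvg; rewrite fineK// (integrable_fin_num measurableT ip).
Qed.

End Dominated.


Let w1_le a i (M : 'M[R]_(n, p)) : `|1 : R| <= 1 + `|M a i|.
Proof. by rewrite normr1 lerDl. Qed.

Let wa_le a i (M : 'M[R]_(n, p)) : `|M a i| <= 1 + `|M a i|.
Proof. by rewrite lerDr. Qed.

Hypothesis p_gt0 : (0 < p)%N.

Let i0 : 'I_p := Ordinal p_gt0.
Let a0 : 'I_n := Ordinal (ltn_trans p_gt0 pn').

Lemma mxint_prior_cvg Y : mxintegrable (fun M => lik N Y M * prior M) /\
  mxint (fun M => lik N Y M * q j M) @[j --> \oo] --> mxint (fun M => lik N Y M * prior M).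
Proof.
have [] := @mxint_reg_cvg Y a0 i0 (fun=> 1) (@mx_measurable_cst R n p 1) (@w1_le a0 i0).
have -> : (fun M => 1 * lik N Y M * prior M) = (fun M => lik N Y M * prior M).
  by apply/funext => M; rewrite mul1r.
have -> // : (fun j => mxint (fun M => 1 * lik N Y M * q j M)) =
    (fun j => mxint (fun M => lik N Y M * q j M)).
by apply/funext => j; congr (mx_Rintegral _ _ _); apply/funext => M; rewrite mul1r.
Qed.

Lemma marginal_integral Y :
  marginal N prior Y = (mxint (fun M => lik N Y M * prior M))%:E.
Proof.
rewrite /marginal matintE.
- have [ip _] := mxint_prior_cvg Y.
  by rewrite /mx_Rintegral /Rintegral fineK// (integrable_fin_num measurableT ip).
- apply: mx_measurable_EFin; apply: mx_measurableM; first exact: mx_measurable_lik.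
  exact: mprior.
- by move=> M; rewrite lee_fin mulr_ge0 ?pi_MSVS2_ge0// ltW// lik_gt0.
Qed.

(** The prior vanishes at rank-deficient matrices, so it is compared almost everywhere with [q 0],
    which is positive at every matrix. *)
Lemma marginal_gt0 Y : (0 < marginal N prior Y)%E.
Proof.
have [ip _] := mxint_prior_cvg Y.
have mq0 : mx_measurable (fun M => lik N Y M * q 0 M).
  by apply: mx_measurableM; [exact: mx_measurable_lik|exact: mq].
rewrite marginal_integral.
have -> : (mxint (fun M => lik N Y M * prior M))%:E = (\int[mu]_v (lik N Y (ev v) * prior
  (ev v))%:E)%E.
  by rewrite /mx_Rintegral /Rintegral fineK// (integrable_fin_num measurableT ip).
apply: lt_le_trans (mxint_gt0 mev matintE N0 mq0 _) _ => [M|].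
  by rewrite mulr_gt0 ?lik_gt0.
apply: ae_ge0_le_integral => //.
- by move=> v _; rewrite lee_fin mulr_ge0// ltW// lik_gt0.
- exact: (measurable_mxint_fun mev mq0).
- by move=> v _; rewrite lee_fin mulr_ge0 ?pi_MSVS2_ge0// ltW// lik_gt0.
- by case/integrableP: ip.
- apply: filterS ae_fullrank => v fr _; rewrite lee_fin ler_pM2l ?lik_gt0//.
  exact: (reg_prior_le_pi gam0 pn (eps_gt0 0) fr).
Qed.

Lemma matint_signed_mxint (f : 'M[R]_(n, p) -> R) : mx_measurable f ->
  fine (matint_signed f) = mxint f.
Proof.
move=> mf; rewrite /matint_signed.
have mmax (g : 'M[R]_(n, p) -> R) : mx_measurable g ->
    mx_measurable (fun M => (Num.max (g M) 0)%:E).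
  move=> mg d' U e me; apply/measurable_EFinP.
  by apply: measurable_maxr; [exact: mg|exact: measurable_cst].
rewrite !matintE; last 4 first.
- exact/mmax/mx_measurableN.
- by move=> M; rewrite lee_fin le_max lexx orbT.
- exact: mmax.
- by move=> M; rewrite lee_fin le_max lexx orbT.
rewrite /mx_Rintegral /Rintegral [X in _ = fine X]integralE; congr (fine (_ - _)%E).
  by apply: eq_integral => v _; rewrite funeposE EFin_max.
by apply: eq_integral => v _; rewrite funenegE EFin_max EFinN.
Qed.

Lemma gen_bayesE Y a i : gen_bayes N prior Y a i =
  mxint (fun M => M a i * lik N Y M * prior M) / mxint (fun M => lik N Y M * prior M).
Proof.
rewrite mxE marginal_integral matint_signed_mxint//.
apply: mx_measurableM; last exact: mprior.
by apply: mx_measurableM; [exact: mx_measurable_coef|exact: mx_measurable_lik].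
Qed.

Lemma post_mean_cvg Y a i :
  post_mean mu ev N (q j) Y a i @[j --> \oo] --> gen_bayes N prior Y a i.
Proof.
rewrite gen_bayesE.
have [_ h1] := mxint_reg_cvg Y (@mx_measurable_coef R n p a i) (@wa_le a i).
have [_ h2] := mxint_prior_cvg Y.
have m0 : mxint (fun M => lik N Y M * prior M) != 0.
  by have := marginal_gt0 Y; rewrite marginal_integral lte_fin => /gt_eqF ->.
rewrite (_ : (fun j => post_mean mu ev N (q j) Y a i) = fun j =>
    mxint (fun M => M a i * lik N Y M * q j M) / mxint (fun M => lik N Y M * q j M)).
  exact: (cvgM h1 (cvgV m0 h2)).
by apply/funext => j; rewrite mxE.
Qed.

Theorem risk_gen_bayes_le X :
  (risk N (gen_bayes N prior) X <= ((n * p)%:R / N)%:E)%E.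
Proof.
pose f j Y := lik N X Y * frob2 (post_mean mu ev N (q j) Y - X).
have mf j : mx_measurable (f j) := mx_measurable_loss mev matintE N0 (sh j) X.
have fg Y : f j Y @[j --> \oo] --> lik N Y X * frob2 (gen_bayes N prior Y - X).
  rewrite [lik N Y X]lik_sym; apply: cvgM; first exact: cvg_cst.
  apply: cvg_big => [|a _]; first exact: add_continuous.
  apply: cvg_big => [|i _]; first exact: add_continuous.
  have h := @post_mean_cvg Y a i.
  have h' : (post_mean mu ev N (q j) Y - X) a i @[j --> \oo] --> (gen_bayes N prior Y - X) a i.
    have coefB (A : 'M[R]_(n, p)) : (A - X) a i = A a i - X a i by rewrite !mxE.
    rewrite coefB (_ : (fun j => (post_mean mu ev N (q j) Y - X) a i) =
        fun j => post_mean mu ev N (q j) Y a i - X a i).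
      exact: (cvgB h (cvg_cst _)).
    by apply/funext => j; rewrite coefB.
  exact: (cvgM h' h').
(* The loss is measurable as the pointwise limit of the losses of the regularised posterior
   means. *)
have mg : mx_measurable (fun Y => (lik N Y X * frob2 (gen_bayes N prior Y - X))%:E).
  by apply: mx_measurable_EFin; exact: (mx_measurable_cvg mf fg).
rewrite /risk matintE//; last first.
  by move=> M; rewrite lee_fin mulr_ge0 ?frob2_ge0// ltW// lik_gt0.
apply: (@fatou_cvg_le _ _ _ mu (fun j v => (f j (ev v))%:E)).
- by move=> j; exact: (measurable_mxint_fun mev (mf j)).
- by move=> j v; rewrite lee_fin mulr_ge0 ?frob2_ge0// ltW// lik_gt0.
- by move=> v; apply: cvg_EFin; [exact: nearW|exact: fg].
- by move=> j; exact: (risk_post_mean_le mev matintE N0 (sh j) X).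
Qed.

End SingularLimit.

Theorem theorem7 (R : realType) (n p : nat) (N gamma : R)
  (hp : (3 <= p)%N) (hn1 : (p + 2 <= n)%N) (hn2 : (n < 2 * p)%N)
  (hN : 0 < N) (hg0 : 0 < gamma) (hg1 : gamma <= - n%:R + 2 * p%:R) :
  (forall Y : 'M[R]_(n, p),
     (0 < marginal N (pi_MSVS2 gamma) Y)%E /\ (marginal N (pi_MSVS2 gamma) Y < +oo)%E) /\
  (forall M : 'M[R]_(n, p),
     (risk N (gen_bayes N (pi_MSVS2 gamma)) M <= ((n * p)%:R / N)%:E)%E).
Proof.
have [d [T [mu [ev [mev matintE]]]]] := matint_integral R n p.
have pn : (p + 1 < n)%N by rewrite addn1 -addn2.
have p0 : (0 < p)%N by exact: leq_trans hp.
split=> [Y|M].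
  split; first exact: (marginal_gt0 mev matintE).
  by rewrite (marginal_integral mev matintE)// ltry.
exact: (risk_gen_bayes_le mev matintE).
Qed.
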